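(* (Derived Tree Theorem) Let $\kappa$ be strongly inaccessible, let $\mathbb{P}$ be a forcing of size $<\kappa$ with largest element $1$, and let $\dot T$ be a $\mathbb{P}$-name such that $1$ forces $\dot T$ to be a regular $\check\kappa$-tree. Then $\mathrm{Der}(\dot T)$ is isomorphic to a regular $\kappa$-tree, and moreover: if $[(\dot\tau,\alpha)]\in\mathrm{Der}(\dot T)$ and $X$ is the set of all $\dot\rho$ such that $[(\dot\rho,\alpha+1)]$ is a successor of $[(\dot\tau,\alpha)]$ in $\mathrm{Der}(\dot T)$, then $1$ forces that every successor of $\dot\tau$ in $\dot T$ is named by an element of $\check X$ (i.e., is equal to the interpretation of some element of $X$).
   Context: A tree is a subset of ${}^{<\kappa}\kappa$ closed under initial segments; $s\sqsubseteq t$ means $s$ is an initial segment of $t$, $\mathrm{Dom}(t)$ is the length of $t$. A regular $\kappa$-tree is a tree $T\subseteq{}^{<\kappa}\kappa$ of height $\kappa$ all of whose levels have size $<\kappa$, every maximal branch of which has length $\kappa$, and which is perfect (every $t\in T$ has two incomparable extensions in $T$). Successor means immediate successor. Derived tree: let $\mathbb{P}$ have largest element $1$ and let $\dot T$ be a name with $1$ forcing $\dot T$ to be a subtree of ${}^{<\check\kappa}\check\kappa$. The elements of $\mathrm{Der}(\dot T)$ are equivalence classes $[(\dot\tau,\alpha)]$ of pairs $(\dot\tau,\alpha)$ with $\alpha<\kappa$ and $1\Vdash(\dot\tau\in\dot T\text{ and }\mathrm{Dom}(\dot\tau)=\check\alpha)$, where $(\dot\tau_1,\alpha_1)\cong(\dot\tau_2,\alpha_2)$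 iff $1\Vdash\dot\tau_1=\dot\tau_2$. The order is $[(\dot\tau_1,\alpha_1)]<[(\dot\tau_2,\alpha_2)]$ iff $1\Vdash(\dot\tau_1\sqsubseteq\dot\tau_2\text{ and }\dot\tau_1\neq\dot\tau_2)$. Level $\beta$ of $\mathrm{Der}(\dot T)$ consists of the classes $[(\dot\tau,\beta)]$. *)

(* Defs.v *)
(** * First-order formulas of set theory

    A formula carries its parameters from a domain [D]; a quantifier takes a
    [D]-indexed family.  All notions below are written once, for arbitrary [D],
    and are then read in the ground model ([sat], with [D := V]) or in the
    forcing language ([forces], with [D := name P]).
    [Lit Q] is a statement about the ground model. *)

Inductive form (D : Type) : Type :=
| Mem (x y : D)
| Eq (x y : D)
| Lit (Q : Prop)
| Not (a : form D)
| And (a b : form D)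
| All (f : D -> form D).

Arguments Mem {D} x y.
Arguments Eq {D} x y.
Arguments Lit {D} Q.
Arguments Not {D} a.
Arguments And {D} a b.
Arguments All {D} f.

Definition Or {D} (a b : form D) : form D := Not (And (Not a) (Not b)).
Definition Imp {D} (a b : form D) : form D := Not (And a (Not b)).
Definition Iff {D} (a b : form D) : form D := And (Imp a b) (Imp b a).
Definition Ex {D} (f : D -> form D) : form D := Not (All (fun x => Not (f x))).

Declare Scope form_scope.
Delimit Scope form_scope with form.
Bind Scope form_scope with form.

Notation "x \in y" := (Mem x y) (at level 70, no associativity) : form_scope.
Notation "x == y" := (Eq x y) (at level 70, no associativity) : form_scope.
Notation "~ a" := (Not a) : form_scope.
Notation "a /\ b" := (And a b) : form_scope.
Notation "a \/ b" := (Or a b) : form_scope.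
Notation "a \imp b" := (Imp a b) (at level 90, right associativity) : form_scope.
Notation "a \iff b" := (Iff a b) (at level 95, no associativity) : form_scope.
Notation "\all x , a" := (All (fun x => a%form))
  (at level 200, x name, a at level 200) : form_scope.
Notation "\ex x , a" := (Ex (fun x => a%form))
  (at level 200, x name, a at level 200) : form_scope.
Notation "\all x \in y , a" := (All (fun x => Imp (Mem x y) a%form))
  (at level 200, x name, y at level 69, a at level 200) : form_scope.
Notation "\ex x \in y , a" := (Ex (fun x => And (Mem x y) a%form))
  (at level 200, x name, y at level 69, a at level 200) : form_scope.

Local Open Scope form_scope.

(** ** Sets, functions, cardinality *)

Definition subset {D} (x y : D) : form D := \all z \in x, z \in y.

Definition is_upair {D} (z a b : D) : form D :=
  \all w, (w \in z \iff (w == a \/ w == b)).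

(* Kuratowski pair *)
Definition is_pair {D} (z a b : D) : form D :=
  \ex u, \ex v, (is_upair u a a /\ is_upair v a b /\ is_upair z u v).

(* the pair (a,b) belongs to f *)
Definition maps {D} (f a b : D) : form D := \ex z \in f, is_pair z a b.

(* f is a function and Dom(f) = d *)
Definition fun_on {D} (f d : D) : form D :=
  (\all z \in f, \ex a \in d, \ex b, is_pair z a b)
  /\ (\all a \in d, \ex b, maps f a b)
  /\ (\all a, \all b, \all c, ((maps f a b /\ maps f a c) \imp b == c)).

Definition fun_from_to {D} (f d c : D) : form D :=
  fun_on f d /\ (\all a, \all b, (maps f a b \imp b \in c)).

Definition injects {D} (x y : D) : form D :=
  \ex f, (fun_from_to f x y
          /\ \all a, \all b, \all c, ((maps f a c /\ maps f b c) \imp a == b)).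

(* |x| < |y| *)
Definition card_lt {D} (x y : D) : form D := injects x y /\ ~ injects y x.

Definition is_power {D} (p x : D) : form D := \all z, (z \in p \iff subset z x).

(** ** Ordinals *)

(* well-foundedness of the membership relation on x is the axiom of foundation *)
Definition ordinal {D} (x : D) : form D :=
  (\all y \in x, subset y x)
  /\ (\all y \in x, \all z \in x, (y \in z \/ y == z \/ z \in y)).

(* b = a + 1 *)
Definition is_succ {D} (a b : D) : form D := \all w, (w \in b \iff (w \in a \/ w == a)).

Definition inductive_set {D} (w : D) : form D :=
  (\ex e \in w, \all z, ~ (z \in e))
  /\ (\all a \in w, \ex b \in w, is_succ a b).

Definition is_omega {D} (w : D) : form D :=
  inductive_set w /\ \all v, (inductive_set v \imp subset w v).

(* uncountable, regular, strong limit cardinal *)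
Definition inaccessible {D} (k : D) : form D :=
  ordinal k
  /\ (\all a \in k, card_lt a k)
  /\ (\ex w, (is_omega w /\ card_lt w k))
  /\ (\all a \in k, \all f, (fun_from_to f a k \imp
        \ex b \in k, \all x, \all y, (maps f x y \imp y \in b)))
  /\ (\all a \in k, \all p, (is_power p a \imp card_lt p k)).

(** ** Trees *)

(* s is the restriction of t to some ordinal *)
Definition init_seg {D} (s t : D) : form D :=
  \ex a, (ordinal a
          /\ \all z, (z \in s \iff (z \in t /\ \ex x \in a, \ex y, is_pair z x y))).

Definition proper_init_seg {D} (s t : D) : form D := init_seg s t /\ ~ (s == t).

Definition is_tree {D} (T k : D) : form D :=
  (\all t \in T, \ex a \in k, fun_from_to t a k)
  /\ (\all t \in T, \all s, (init_seg s t \imp s \in T)).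

Definition is_level {D} (L T a : D) : form D :=
  \all t, (t \in L \iff (t \in T /\ fun_on t a)).

(* h is the least ordinal a such that level a of T is empty *)
Definition has_height {D} (T h : D) : form D :=
  ordinal h
  /\ (\all a \in h, \ex t \in T, fun_on t a)
  /\ ~ (\ex t \in T, fun_on t h).

Definition is_chain {D} (b T : D) : form D :=
  subset b T /\ \all s \in b, \all t \in b, (init_seg s t \/ init_seg t s).

(* maximal chains; by maximality they are closed under initial segments *)
Definition is_max_branch {D} (b T : D) : form D :=
  is_chain b T /\ \all c, ((is_chain c T /\ subset b c) \imp c == b).

(* On a chain closed under initial segments, Dom is an order isomorphism onto
   the order type, so the length is the set of all Dom(t) for t in b. *)
Definition has_length {D} (b h : D) : form D :=
  ordinal h /\ \all a, (a \in h \iff \ex t \in b, fun_on t a).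

Definition perfect {D} (T : D) : form D :=
  \all t \in T, \ex u \in T, \ex v \in T,
    (init_seg t u /\ init_seg t v /\ ~ init_seg u v /\ ~ init_seg v u).

Definition regular_tree {D} (T k : D) : form D :=
  is_tree T k
  /\ has_height T k
  /\ (\all a \in k, \all L, (is_level L T a \imp card_lt L k))
  /\ (\all b, (is_max_branch b T \imp has_length b k))
  /\ perfect T.

(* s is an immediate successor of t in T *)
Definition succ_in {D} (T t s : D) : form D :=
  s \in T /\ proper_init_seg t s
  /\ ~ (\ex u \in T, (proper_init_seg t u /\ proper_init_seg u s)).

Local Close Scope form_scope.

(** * The ground model *)

(* One universe of index types, shared by sets and names, so that the names are
   exactly those of the ground model [V]. *)
Definition U := Type.

(* Well-founded sets, up to the extensional equality [Veq]. *)
Inductive V : Type := Vset (A : U) (f : A -> V).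

Fixpoint Veq (x y : V) : Prop :=
  match x, y with
  | Vset A f, Vset B g =>
      (forall a, exists b, Veq (f a) (g b)) /\ (forall b, exists a, Veq (f a) (g b))
  end.

Definition Vmem (x y : V) : Prop :=
  match y with Vset B g => exists b, Veq x (g b) end.

Fixpoint sat (f : form V) : Prop :=
  match f with
  | Mem x y => Vmem x y
  | Eq x y => Veq x y
  | Lit Q => Q
  | Not a => ~ sat a
  | And a b => sat a /\ sat b
  | All g => forall x, sat (g x)
  end.

(** * Forcing *)

Record forcing : Type := Forcing {
  cond :> Type;
  le : cond -> cond -> Prop;
  one : cond;
  le_refl : forall p, le p p;
  le_trans : forall p q r, le p q -> le q r -> le p r;
  le_one : forall p, le p one
}.

Arguments le {f} _ _.
Arguments one {f}.

(* P is in bijection with a set of V of cardinality less than k *)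
Definition size_lt (P : Type) (k : V) : Prop :=
  exists (x : V) (e : P -> V),
    (forall p, Vmem (e p) x)
    /\ (forall y, Vmem y x -> exists p, Veq y (e p))
    /\ (forall p q, Veq (e p) (e q) -> p = q)
    /\ sat (card_lt x k).

(* [Name A f c] is the name consisting of the pairs (f a, c a) for a in A. *)
Inductive name (P : forcing) : Type :=
  Name (A : U) (f : A -> name P) (c : A -> P).

Arguments Name {P} A f c.

Fixpoint check {P : forcing} (x : V) : name P :=
  match x with Vset A f => Name A (fun a => check (f a)) (fun _ => one) end.

(* p forces x = y when, for each (s, c) in x, every condition below p and c
   forces s to be in y (see [forces_mem]), and symmetrically. *)
Fixpoint forces_eq {P : forcing} (x y : name P) (p : P) : Prop :=
  match x, y with
  | Name A f c, Name B g d =>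
      (forall a q, le q p -> le q (c a) ->
         exists r b, le r q /\ le r (d b) /\ forces_eq (f a) (g b) r)
      /\
      (forall b q, le q p -> le q (d b) ->
         exists r a, le r q /\ le r (c a) /\ forces_eq (f a) (g b) r)
  end.

(* the conditions r below some d b with r forcing x = g b are dense below p *)
Definition forces_mem {P : forcing} (x y : name P) (p : P) : Prop :=
  match y with
  | Name B g d =>
      forall q, le q p -> exists r b, le r q /\ le r (d b) /\ forces_eq x (g b) r
  end.

Fixpoint forces {P : forcing} (p : P) (f : form (name P)) : Prop :=
  match f with
  | Mem x y => forces_mem x y p
  | Eq x y => forces_eq x y p
  | Lit Q => Q
  | Not a => forall q, le q p -> ~ forces q a
  | And a b => forces p a /\ forces p b
  | All g => forall x, forces p (g x)
  end.

(** * The derived tree *)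

(* the pairs (tau, alpha) *)
Record der_pair {P : forcing} (k : V) (T : name P) : Type := DerPair {
  dname : name P;
  dlen : V;
  dlen_lt : Vmem dlen k;
  dname_in : forces one (Mem dname T /\ fun_on dname (check dlen))%form
}.

Arguments dname {P k T} _.
Arguments dlen {P k T} _.

Definition der_equiv {P : forcing} {k : V} {T : name P} (x y : der_pair k T) : Prop :=
  forces one (Eq (dname x) (dname y)).

Definition Der {P : forcing} (k : V) (T : name P) : Type :=
  {c : der_pair k T -> Prop | exists x, c = der_equiv x}.

Definition der_class {P : forcing} {k : V} {T : name P} (x : der_pair k T) : Der k T :=
  exist _ (der_equiv x) (ex_intro _ x eq_refl).

Definition der_lt {P : forcing} {k : V} {T : name P} (c d : Der k T) : Prop :=
  exists x y, c = der_class x /\ d = der_class y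
    /\ forces one (proper_init_seg (dname x) (dname y)).

Definition der_succ {P : forcing} {k : V} {T : name P} (c d : Der k T) : Prop :=
  der_lt c d /\ ~ exists e, der_lt c e /\ der_lt e d.

Definition der_isomorphic {P : forcing} (k : V) (T : name P) (S : V) : Prop :=
  exists phi : Der k T -> V,
    (forall c, Vmem (phi c) S)
    /\ (forall s, Vmem s S -> exists c, Veq (phi c) s)
    /\ (forall c d, Veq (phi c) (phi d) -> c = d)
    /\ (forall c d, der_lt c d <-> sat (proper_init_seg (phi c) (phi d))).

(* rho such that [(rho, alpha + 1)] is a successor of [(tau, alpha)], for x = (tau, alpha) *)
Definition der_succ_name {P : forcing} {k : V} {T : name P}
    (x : der_pair k T) (rho : name P) : Prop :=
  exists y : der_pair k T,
    dname y = rho /\ sat (is_succ (dlen x) (dlen y))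
    /\ der_succ (der_class x) (der_class y).

(* Main.v *)
Require Import Defs.
From Stdlib Require Import Classical ClassicalEpsilon FunctionalExtensionality
  PropExtensionality ProofIrrelevance Setoid Morphisms.
From mathcomp Require classical_sets.

(** Forcing with [P] and truth in [V] obey the same rules, so both are presented as a
    [model]: a set of worlds with a forcing relation.  In every model, initial segments
    among functions on ordinals are just subsets.

    Names for nodes exist by fullness (mixing along a well-order of [P]).  A chain of [T]
    lies on a maximal branch, obtained by Zorn's lemma on names for subsets of [T]; since
    it has length [kappa], every forced chain of nodes has a common extension, or an
    initial segment, at any given level below [kappa].

    A level of [Der T] has size less than [kappa]: fix a name [fh] for an injection of the
    level of [T] into [kappa].  A node [t] is determined by the values of [fh t] decided by
    the various conditions.  If the values decided by one condition [p] were unbounded in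
    [kappa], then [p] would force [kappa] to inject into the level; so by regularity all
    decided values are below some [lam < kappa], and nodes are coded by subsets of
    [P * lam], of which there are fewer than [kappa].

    Coding each node [t] of length [a] by the sequence of the codes of its restrictions
    to the successors [b + 1], [b < a], gives the isomorphic tree. *)

(** The obstacle throughout is that objects of [T] are usually available only below some condition,
    whereas elements of [Der] must be named by [one]. Two devices bridge this gap. Fullness turns an
    existential statement forced by [one] into a single name. On top of it, [uniform_extend] absorbs
    a node known only below certain conditions into a node named by [one]: it decides densely
    whether the given name is such a node, and extends either that node or a fallback. Perfectness
    and the statement on successors both rest on it.

    The bound on the size of [P] enters in two ways: an injection of [P] into [kappa] supplies the
    ranks used for mixing, and smallness keeps few the possible sets of decided values.

    Neither equality in [V] nor forced equality of names is identity of terms. Hence formulas are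
    rewritten only after a proof that they respect equality, and meta-level functions on [V] carry
    extensionality hypotheses. *)

Record model (D : Type) : Type := Model {
  world : Type;
  wle : world -> world -> Prop;
  frc : world -> form D -> Prop;
  wle_refl : forall p, wle p p;
  wle_trans : forall p q r, wle p q -> wle q r -> wle p r;
  frc_mono : forall p q a, wle q p -> frc p a -> frc q a;
  frc_dense : forall p a,
    (forall q, wle q p -> exists r, wle r q /\ frc r a) -> frc p a;
  frc_lit : forall p Q, frc p (Lit Q) <-> Q;
  frc_not : forall p a, frc p (Not a) <-> forall q, wle q p -> ~ frc q a;
  frc_and : forall p a b, frc p (And a b) <-> frc p a /\ frc p b;
  frc_all : forall p f, frc p (All f) <-> forall x, frc p (f x);
  frc_eq_refl : forall p x, frc p (Eq x x);
  frc_eq_sym : forall p x y, frc p (Eq x y) -> frc p (Eq y x);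
  frc_eq_trans : forall p x y z, frc p (Eq x y) -> frc p (Eq y z) -> frc p (Eq x z);
  frc_mem_l : forall p x y z, frc p (Eq x y) -> frc p (Mem x z) -> frc p (Mem y z);
  frc_mem_r : forall p x y z, frc p (Eq y z) -> frc p (Mem x y) -> frc p (Mem x z);
  frc_ext : forall p x y,
    (forall q z, wle q p -> (frc q (Mem z x) <-> frc q (Mem z y))) -> frc p (Eq x y);
  frc_pairing : forall a b, exists z, forall p w,
    frc p (Mem w z) <-> frc p (Or (Eq w a) (Eq w b));
  frc_separation : forall phi : D -> form D,
    (forall p x y, frc p (Eq x y) -> frc p (phi x) -> frc p (phi y)) ->
    forall t, exists s, forall p z,
      frc p (Mem z s) <-> frc p (Mem z t) /\ frc p (phi z)
}.

Arguments world {D} m.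
Arguments wle {D m} _ _ : simpl never.
Arguments frc {D m} _ _%_form : simpl never.

Notation "p ||- a" := (frc p a%form) (at level 75, a at level 74, no associativity).

(** * Derived rules of the forcing relation *)

Section Logic.
Context {D : Type} {M : model D}.
Implicit Types (p q r : world M) (a b c : form D) (x y z s t u v w f g d e k : D).

(** [Imp] abbreviates a negated conjunction, so when [q] forces [a] one only learns that no
    condition below [q] forces the negation of [b]. Hence the conditions forcing [b] are dense below
    [q], and [frc_dense] finishes. *)
Lemma frc_imp p a b : p ||- Imp a b <-> forall q, wle q p -> q ||- a -> q ||- b.
Proof.
  unfold Imp. rewrite frc_not. split.
  - intros H q Hq Ha. apply frc_dense. intros r Hr.
    destruct (classic (exists r', wle r' r /\ r' ||- b)) as [E|N]; [exact E|].
    exfalso. apply (H r); [eapply wle_trans; eassumption|].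
    rewrite frc_and, frc_not. split; [eapply frc_mono; eassumption|].
    intros r' Hr' Hb. apply N. eauto.
  - intros H q Hq Hab. rewrite frc_and, frc_not in Hab. destruct Hab as [Ha Hb].
    apply (Hb q (wle_refl _ _ _)). auto.
Qed.

Lemma frc_mp p a b : p ||- Imp a b -> p ||- a -> p ||- b.
Proof. rewrite frc_imp. intros H; apply H, wle_refl. Qed.

Lemma frc_iff p a b : p ||- Iff a b <-> forall q, wle q p -> (q ||- a <-> q ||- b).
Proof.
  unfold Iff. rewrite frc_and, !frc_imp. firstorder.
Qed.

Lemma frc_ex_intro p (f : D -> form D) x : p ||- f x -> p ||- Ex f.
Proof.
  intros H. unfold Ex. rewrite frc_not. intros q Hq N.
  rewrite frc_all in N. specialize (N x). rewrite frc_not in N.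
  apply (N q (wle_refl _ _ _)). eapply frc_mono; eassumption.
Qed.

Lemma frc_ex_dense p (f : D -> form D) :
  p ||- Ex f -> forall q, wle q p -> exists r x, wle r q /\ r ||- f x.
Proof.
  unfold Ex. rewrite frc_not. intros H q Hq.
  apply NNPP. intros N. apply (H q Hq). rewrite frc_all. intros x.
  rewrite frc_not. intros r Hr Hx. apply N. eauto.
Qed.

(** No single witness need be known at [p]: witnesses exist densely below [p], and a consequence
    derived from them there returns to [p] by density. *)
Lemma frc_ex_elim p (f : D -> form D) c :
  p ||- Ex f -> (forall q x, wle q p -> q ||- f x -> q ||- c) -> p ||- c.
Proof.
  intros H K. apply frc_dense. intros q Hq.
  destruct (frc_ex_dense _ _ H q Hq) as (r & x & Hr & Hx).
  exists r. split; [exact Hr|]. apply (K r x); [|exact Hx].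
  eapply wle_trans; eassumption.
Qed.

Lemma frc_or_l p a b : p ||- a -> p ||- Or a b.
Proof.
  intros H. unfold Or. rewrite frc_not. intros q Hq N. rewrite frc_and, !frc_not in N.
  apply (proj1 N q (wle_refl _ _ _)). eapply frc_mono; eassumption.
Qed.

Lemma frc_or_r p a b : p ||- b -> p ||- Or a b.
Proof.
  intros H. unfold Or. rewrite frc_not. intros q Hq N. rewrite frc_and, !frc_not in N.
  apply (proj2 N q (wle_refl _ _ _)). eapply frc_mono; eassumption.
Qed.

Lemma frc_or_dense p a b :
  p ||- Or a b -> forall q, wle q p -> exists r, wle r q /\ (r ||- a \/ r ||- b).
Proof.
  unfold Or. rewrite frc_not. intros H q Hq.
  apply NNPP. intros N. apply (H q Hq). rewrite frc_and, !frc_not.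
  split; intros r Hr Hx; apply N; eauto.
Qed.

Lemma frc_or_elim p a b c :
  p ||- Or a b -> (forall q, wle q p -> q ||- a -> q ||- c) ->
  (forall q, wle q p -> q ||- b -> q ||- c) -> p ||- c.
Proof.
  intros H K L. apply frc_dense. intros q Hq.
  destruct (frc_or_dense _ _ _ H q Hq) as (r & Hr & Hx).
  exists r. split; [exact Hr|].
  assert (wle r p) by (eapply wle_trans; eassumption).
  destruct Hx; auto.
Qed.

Lemma frc_absurd p a c : p ||- Not a -> p ||- a -> p ||- c.
Proof.
  rewrite frc_not. intros H Ha. exfalso. apply (H p (wle_refl _ _ _) Ha).
Qed.

Lemma frc_by_contra p a :
  (forall q, wle q p -> q ||- Not a -> False) -> p ||- a.
Proof.
  intros H. apply frc_dense. intros q Hq.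
  apply NNPP. intros N. apply (H q Hq). rewrite frc_not. intros r Hr Ha. eauto.
Qed.

Lemma frc_not_intro p a : (forall q, wle q p -> q ||- a -> False) -> p ||- Not a.
Proof. rewrite frc_not. auto. Qed.

(** The conditions deciding [a] are dense. *)
Lemma frc_em p a c :
  (forall q, wle q p -> q ||- a -> q ||- c) ->
  (forall q, wle q p -> q ||- Not a -> q ||- c) -> p ||- c.
Proof.
  intros H K. apply frc_dense. intros q Hq.
  destruct (classic (exists r, wle r q /\ r ||- a)) as [(r & Hr & Ha)|N].
  - exists r. split; [exact Hr|]. apply H; [eapply wle_trans; eassumption|exact Ha].
  - exists q. split; [apply wle_refl|]. apply K; [exact Hq|].
    rewrite frc_not. intros r Hr Ha. eauto.
Qed.

(** An arbitrary meta-level [phi] need not respect forced equality, so substitution has to be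
    justified. For concrete formulas [congr_tac] builds the justification from the atomic cases. *)
Definition congruent (phi : D -> form D) : Prop :=
  forall p x y, p ||- x == y -> p ||- phi x -> p ||- phi y.

Lemma congruent_const a : congruent (fun _ => a).
Proof. intros p x y _ H. exact H. Qed.

Lemma congruent_mem_l z : congruent (fun x => Mem x z).
Proof. intros p x y. apply frc_mem_l. Qed.

Lemma congruent_mem_r z : congruent (fun x => Mem z x).
Proof. intros p x y. apply frc_mem_r. Qed.

Lemma congruent_eq_l z : congruent (fun x => Eq x z).
Proof. intros p x y H K. eapply frc_eq_trans; [apply frc_eq_sym|]; eassumption. Qed.

Lemma congruent_eq_r z : congruent (fun x => Eq z x).
Proof. intros p x y H K. eapply frc_eq_trans; eassumption. Qed.

Lemma congruent_not phi : congruent phi -> congruent (fun x => Not (phi x)).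
Proof.
  intros H p x y E. rewrite !frc_not. intros N q Hq Hy. apply (N q Hq).
  apply (H q y x); [|exact Hy]. apply frc_eq_sym. eapply frc_mono; eassumption.
Qed.

Lemma congruent_and phi psi :
  congruent phi -> congruent psi -> congruent (fun x => And (phi x) (psi x)).
Proof. intros H K p x y E. rewrite !frc_and. intros [? ?]. split; eauto. Qed.

Lemma congruent_all (phi : D -> D -> form D) :
  (forall z, congruent (fun x => phi x z)) -> congruent (fun x => All (phi x)).
Proof. intros H p x y E. rewrite !frc_all. intros K z. eapply (H z); eauto. Qed.

Lemma congruent_rewrite phi : congruent phi ->
  forall p x y, p ||- x == y -> p ||- phi y -> p ||- phi x.
Proof. intros H p x y E. apply H. apply frc_eq_sym, E. Qed.

End Logic.

Ltac congr_tac :=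
  unfold regular_tree, perfect, is_max_branch, has_length, has_height, is_level,
    succ_in, proper_init_seg, is_chain, is_tree, init_seg, card_lt, injects,
    fun_from_to, fun_on, maps, is_pair, is_upair, ordinal, subset, Ex, Iff, Imp, Or;
  repeat first
    [ apply congruent_const
    | apply congruent_mem_l | apply congruent_mem_r
    | apply congruent_eq_l | apply congruent_eq_r
    | apply congruent_not | apply congruent_and
    | apply congruent_all; intro ].

(* [down H] with [H : wle q p] moves every hypothesis forced by [p] to [q]. *)
Ltac down H :=
  match type of H with
  | wle ?q ?p =>
      repeat match goal with
      | K : frc p _ |- _ => apply (frc_mono _ _ _ _ _ H) in K
      | K : wle p ?p0 |- _ => apply (wle_trans _ _ _ _ _ H) in K
      end
  end.

Tactic Notation "fex" hyp(H) "as" ident(x) simple_intropattern(pat) :=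
  let q := fresh "q" in let L := fresh "L" in let K := fresh in
  eapply (frc_ex_elim _ _ _ H); clear H; intros q x L K; down L; revert K; intros pat.

Tactic Notation "for" hyp(H) "as" simple_intropattern(pat) :=
  let q := fresh "q" in let L := fresh "L" in let K := fresh in
  eapply (frc_or_elim _ _ _ _ H); clear H; intros q L K; down L; revert K; intros pat.

Ltac fsplit := apply frc_and; split.
Tactic Notation "fand" hyp(H) "as" simple_intropattern(pat) :=
  rewrite ?frc_and in H; destruct H as pat.
Ltac fimp H :=
  let q := fresh "q" in let L := fresh "L" in
  apply frc_imp; intros q L H; down L.
Ltac fall x := apply frc_all; intros x.
Ltac fwit x := apply (frc_ex_intro _ _ x).
Ltac fnot H :=
  let q := fresh "q" in let L := fresh "L" in
  apply frc_not_intro; intros q L H; down L.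

Tactic Notation "fspec" hyp(H) constr(x) := rewrite frc_all in H; specialize (H x); cbv beta in H.

(* [frw H] with [H : p ||- x == y] rewrites [x] into [y] in the goal, [frwin H K] in [K]. *)
Ltac frw H :=
  match type of H with frc ?p (Eq ?x ?y) =>
    match goal with |- frc p ?G =>
      let G' := eval pattern x in G in
      match G' with ?F _ =>
        refine (congruent_rewrite F _ p x y H _); [congr_tac|cbv beta] end end end.
Ltac frwin H K :=
  match type of H with @frc _ ?M ?p (Eq ?x ?y) =>
    match type of K with frc p ?G =>
      let G' := eval pattern x in G in
      match G' with ?F _ =>
        let C := fresh in
        assert (C : congruent (M := M) F) by congr_tac;
        apply (C p x y H) in K; cbv beta in K; clear C end end end.

(** * Functions and initial segments in a model *)

Section Functions.
Context {D : Type} {M : model D}.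
Implicit Types (p q r : world M) (a b c x y z s t u v w f g h d e k : D).

Lemma frc_subset p x y :
  p ||- subset x y <-> forall q z, wle q p -> q ||- z \in x -> q ||- z \in y.
Proof.
  unfold subset. rewrite frc_all. split.
  - intros H q z Hq Hz. specialize (H z). rewrite frc_imp in H. auto.
  - intros H z. apply frc_imp. auto.
Qed.

Lemma subset_mem p x y z : p ||- subset x y -> p ||- z \in x -> p ||- z \in y.
Proof. rewrite frc_subset. intros H; apply H, wle_refl. Qed.

Lemma subset_refl p x : p ||- subset x x.
Proof. apply frc_subset. auto. Qed.

Lemma subset_trans p x y z : p ||- subset x y -> p ||- subset y z -> p ||- subset x z.
Proof. rewrite !frc_subset. auto. Qed.

Lemma subset_antisym p x y : p ||- subset x y -> p ||- subset y x -> p ||- x == y.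
Proof. rewrite !frc_subset. intros H K. apply frc_ext. intros q z L; split; auto. Qed.

Lemma eq_subset p x y : p ||- x == y -> p ||- subset x y.
Proof.
  intros H. apply frc_subset. intros q z L. apply frc_mem_r. eapply frc_mono; eassumption.
Qed.

Lemma frc_upair p z a b :
  p ||- is_upair z a b <->
  forall q w, wle q p -> (q ||- w \in z <-> q ||- (w == a \/ w == b)).
Proof.
  unfold is_upair. rewrite frc_all. split.
  - intros H q w L. specialize (H w). rewrite frc_iff in H. auto.
  - intros H w. apply frc_iff. auto.
Qed.

Lemma upair_l p z a b : p ||- is_upair z a b -> p ||- a \in z.
Proof.
  rewrite frc_upair. intros H. apply H; [apply wle_refl|]. apply frc_or_l, frc_eq_refl.
Qed.

Lemma upair_r p z a b : p ||- is_upair z a b -> p ||- b \in z.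
Proof.
  rewrite frc_upair. intros H. apply H; [apply wle_refl|]. apply frc_or_r, frc_eq_refl.
Qed.

Lemma upair_elim p z a b w : p ||- is_upair z a b -> p ||- w \in z -> p ||- (w == a \/ w == b).
Proof. rewrite frc_upair. intros H. apply H, wle_refl. Qed.

Lemma singleton_elim p z a w : p ||- is_upair z a a -> p ||- w \in z -> p ||- w == a.
Proof.
  intros H K. pose proof (upair_elim _ _ _ _ _ H K) as E. for E as E; exact E.
Qed.

Lemma upair_unique p z z' a b : p ||- is_upair z a b -> p ||- is_upair z' a b -> p ||- z == z'.
Proof.
  rewrite !frc_upair. intros H K. apply frc_ext. intros q w L. rewrite H, K; tauto.
Qed.

Lemma upair_exists a b : exists z, forall p, p ||- is_upair z a b.
Proof.
  destruct (frc_pairing _ M a b) as [z Hz]. exists z. intros p. apply frc_upair. auto.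
Qed.

Lemma pair_exists a b : exists z, forall p, p ||- is_pair z a b.
Proof.
  destruct (upair_exists a a) as [u Hu]. destruct (upair_exists a b) as [v Hv].
  destruct (upair_exists u v) as [z Hz]. exists z. intros p.
  unfold is_pair. fwit u. fwit v. repeat fsplit; auto.
Qed.

Lemma pair_unique p z z' a b : p ||- is_pair z a b -> p ||- is_pair z' a b -> p ||- z == z'.
Proof.
  unfold is_pair. intros H K.
  fex H as u H. fex H as v H. fand H as [Hu [Hv Hz]].
  fex K as u' K. fex K as v' K. fand K as [Ku [Kv Kz]].
  pose proof (upair_unique _ _ _ _ _ Hu Ku) as Eu.
  pose proof (upair_unique _ _ _ _ _ Hv Kv) as Ev.
  apply upair_unique with u v; [exact Hz|].
  frw Eu. frw Ev. exact Kz.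
Qed.

Lemma pair_inj_l p z a b c d : p ||- is_pair z a b -> p ||- is_pair z c d -> p ||- a == c.
Proof.
  unfold is_pair. intros H K.
  fex H as u H. fex H as v H. fand H as [Hu [Hv Hz]].
  fex K as u' K. fex K as v' K. fand K as [Ku [Kv Kz]].
  pose proof (upair_elim _ _ _ _ _ Kz (upair_l _ _ _ _ Hz)) as E.
  for E as E.
  - apply (singleton_elim _ _ _ _ Ku). apply (frc_mem_r _ _ _ _ _ _ E), (upair_l _ _ _ _ Hu).
  - apply frc_eq_sym. apply (singleton_elim _ _ _ _ Hu).
    apply frc_eq_sym in E. apply (frc_mem_r _ _ _ _ _ _ E), (upair_l _ _ _ _ Kv).
Qed.

Lemma pair_inj_r p z a b c d : p ||- is_pair z a b -> p ||- is_pair z c d -> p ||- b == d.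
Proof.
  intros H K. pose proof (pair_inj_l _ _ _ _ _ _ H K) as Eac.
  unfold is_pair in H, K.
  fex H as u H. fex H as v H. fand H as [Hu [Hv Hz]].
  fex K as u' K. fex K as v' K. fand K as [Ku [Kv Kz]].
  pose proof (upair_elim _ _ _ _ _ Kz (upair_r _ _ _ _ Hz)) as E.
  pose proof (upair_elim _ _ _ _ _ Hz (upair_r _ _ _ _ Kz)) as F.
  for E as E.
  (* Here the pair of [a] and [b] is the singleton of [c], so [b] equals [c]; either case of [F]
     then gives that [d] has the same value. *)
  - assert (B : q3 ||- b == c).
    { apply (singleton_elim _ _ _ _ Ku), (frc_mem_r _ _ _ _ _ _ E), (upair_r _ _ _ _ Hv). }
    for F as F.
    + frw B. apply frc_eq_sym in Eac. frw Eac. apply frc_eq_sym.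
      apply (singleton_elim _ _ _ _ Hu), (frc_mem_r _ _ _ _ _ _ F), (upair_r _ _ _ _ Kv).
    + frw B. apply frc_eq_sym. apply (singleton_elim _ _ _ _ Ku).
      apply (frc_mem_r _ _ _ _ _ _ E), (frc_mem_r _ _ _ _ _ _ F), (upair_r _ _ _ _ Kv).
  - pose proof (upair_elim _ _ _ _ _ Kv (frc_mem_r _ _ _ _ _ _ E (upair_r _ _ _ _ Hv))) as B.
    apply frc_eq_sym in E.
    pose proof (upair_elim _ _ _ _ _ Hv (frc_mem_r _ _ _ _ _ _ E (upair_r _ _ _ _ Kv))) as C.
    for B as B; [|exact B]. for C as C; [|apply frc_eq_sym; exact C].
    frw B. apply frc_eq_sym in Eac. frw Eac. apply frc_eq_sym, C.
Qed.

Lemma maps_intro p f z a b : p ||- z \in f -> p ||- is_pair z a b -> p ||- maps f a b.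
Proof. intros H K. unfold maps. fwit z. fsplit; assumption. Qed.

Lemma maps_mem p f z a b : p ||- maps f a b -> p ||- is_pair z a b -> p ||- z \in f.
Proof.
  unfold maps. intros H K. fex H as w H. fand H as [H P].
  apply (frc_mem_l _ _ _ w); [|exact H]. apply (pair_unique _ _ _ a b); assumption.
Qed.

Lemma maps_subset p f g a b : p ||- subset f g -> p ||- maps f a b -> p ||- maps g a b.
Proof.
  unfold maps at 1. intros S H. fex H as w H. fand H as [H P].
  apply (maps_intro _ _ w); [|exact P]. eapply subset_mem; eassumption.
Qed.

Lemma fun_on_dom p f d a b : p ||- fun_on f d -> p ||- maps f a b -> p ||- a \in d.
Proof.
  intros F H. unfold fun_on in F. fand F as [F [_ _]]. unfold maps in H.
  fex H as z H. fand H as [Hz Hp]. fspec F z. apply (frc_mp _ _ _ F) in Hz.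
  fex Hz as a' Hz. fand Hz as [Ha Hz]. fex Hz as b' Hz.
  pose proof (pair_inj_l _ _ _ _ _ _ Hp Hz) as E. frw E. exact Ha.
Qed.

Lemma fun_on_total p f d a : p ||- fun_on f d -> p ||- a \in d -> p ||- \ex b, maps f a b.
Proof.
  intros F H. unfold fun_on in F. fand F as [_ [F _]]. fspec F a. apply (frc_mp _ _ _ F H).
Qed.

Lemma fun_on_fun p f d a b c :
  p ||- fun_on f d -> p ||- maps f a b -> p ||- maps f a c -> p ||- b == c.
Proof.
  intros F H K. unfold fun_on in F. fand F as [_ [_ F]]. fspec F a. fspec F b. fspec F c.
  apply (frc_mp _ _ _ F). fsplit; assumption.
Qed.

Lemma fun_on_intro p f d :
  (forall q z, wle q p -> q ||- z \in f -> q ||- \ex a \in d, \ex b, is_pair z a b) ->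
  (forall q a, wle q p -> q ||- a \in d -> q ||- \ex b, maps f a b) ->
  (forall q a b c, wle q p -> q ||- maps f a b -> q ||- maps f a c -> q ||- b == c) ->
  p ||- fun_on f d.
Proof.
  intros H1 H2 H3. unfold fun_on. fsplit; [|fsplit].
  - fall z. apply frc_imp. auto.
  - fall z. apply frc_imp. auto.
  - fall a. fall b. fall c. apply frc_imp. intros q L H. fand H as [Ha Hb]. eauto.
Qed.

Lemma fun_subset p f g d : p ||- fun_on f d ->
  (forall q a b, wle q p -> q ||- a \in d -> q ||- maps f a b -> q ||- maps g a b) ->
  p ||- subset f g.
Proof.
  intros F H. apply frc_subset. intros q z L Hz. down L.
  pose proof F as F'. unfold fun_on in F. fand F as [F [_ _]]. fspec F z.
  apply (frc_mp _ _ _ F) in Hz as K. clear F.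
  fex K as a K. fand K as [Ha K]. fex K as b K.
  apply (maps_mem _ _ _ a b); [|exact K]. apply H; [assumption..|].
  eapply maps_intro; eassumption.
Qed.

Lemma fun_subset_dom p f g d e :
  p ||- fun_on f d -> p ||- fun_on g e -> p ||- subset f g -> p ||- subset d e.
Proof.
  intros F G S. apply frc_subset. intros q a L Ha. down L.
  pose proof (fun_on_total _ _ _ _ F Ha) as K. fex K as b K.
  eapply fun_on_dom; [exact G|]. eauto using maps_subset.
Qed.

Lemma fun_dom_unique p f d e : p ||- fun_on f d -> p ||- fun_on f e -> p ||- d == e.
Proof.
  intros F G. apply subset_antisym; eapply fun_subset_dom;
    [exact F|exact G|apply subset_refl|exact G|exact F|apply subset_refl].
Qed.

Lemma maps_restrict p f g d e a b :
  p ||- fun_on f d -> p ||- fun_on g e -> p ||- subset f g -> p ||- a \in d ->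
  p ||- maps g a b -> p ||- maps f a b.
Proof.
  intros F G S Ha Hab. pose proof (fun_on_total _ _ _ _ F Ha) as K. fex K as b' K.
  assert (E : q ||- b == b') by (apply (fun_on_fun _ _ _ a _ _ G); eauto using maps_subset).
  frw E. exact K.
Qed.

(** At an argument of [f] both functions take the value of the common extension [h]. Hence
    restrictions of one node are compared by length alone. *)
Lemma fun_subset_of_dom p f g h d e c :
  p ||- fun_on f d -> p ||- fun_on g e -> p ||- fun_on h c ->
  p ||- subset f h -> p ||- subset g h -> p ||- subset d e -> p ||- subset f g.
Proof.
  intros F G H Sf Sg Sd. apply (fun_subset _ _ _ _ F). intros q a b L Ha Hab. down L.
  eapply maps_restrict; [exact G|exact H|exact Sg| |eauto using maps_subset].
  eapply subset_mem; eassumption.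
Qed.

Lemma fun_subset_eq p f g d :
  p ||- fun_on f d -> p ||- fun_on g d -> p ||- subset f g -> p ||- f == g.
Proof.
  intros F G S. apply subset_antisym; [exact S|].
  eapply fun_subset_of_dom; [exact G|exact F|exact G|apply subset_refl|exact S|apply subset_refl].
Qed.

Lemma init_seg_subset p s t : p ||- init_seg s t -> p ||- subset s t.
Proof.
  unfold init_seg. intros H. fex H as a H. fand H as [_ H].
  apply frc_subset. intros r z Lr Hz. down Lr. fspec H z.
  rewrite frc_iff in H. apply (H r (wle_refl _ _ _)) in Hz. fand Hz as [Hz _]. exact Hz.
Qed.

Lemma frc_ordinal p x :
  p ||- ordinal x <->
  (forall q y z, wle q p -> q ||- y \in x -> q ||- z \in y -> q ||- z \in x) /\
  (forall q y z, wle q p -> q ||- y \in x -> q ||- z \in x ->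
     q ||- (y \in z \/ y == z \/ z \in y)).
Proof.
  unfold ordinal. rewrite frc_and. split.
  - intros [H K]. split.
    + intros q y z L Hy Hz. down L. fspec H y. apply (frc_mp _ _ _ H) in Hy.
      eapply subset_mem; eassumption.
    + intros q y z L Hy Hz. down L. fspec K y. apply (frc_mp _ _ _ K) in Hy. clear K.
      fspec Hy z. apply (frc_mp _ _ _ Hy Hz).
  - intros [H K]. split.
    + fall y. apply frc_imp. intros q L Hy. apply frc_subset. intros r z L' Hz.
      down L'. eauto.
    + fall y. apply frc_imp. intros q L Hy. fall z. apply frc_imp. intros r L' Hz.
      down L'. eauto.
Qed.

(** The ordinal [a] cutting [s] out of [t] may exceed the domain of [t], so the domain of [s] is the
    intersection of [a] with [d]. *)
Lemma init_seg_dom p s t d : p ||- init_seg s t -> p ||- fun_on t d -> p ||- ordinal d ->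
  p ||- \ex b, (ordinal b /\ subset b d /\ fun_on s b).
Proof.
  unfold init_seg. intros H F O. fex H as a H. fand H as [Oa H].
  destruct (frc_separation _ M (fun x => Mem x a) (congruent_mem_l a) d) as [b Hb].
  assert (S : q ||- subset b d).
  { apply frc_subset. intros r z _. rewrite Hb. tauto. }
  assert (Hs : forall r z, wle r q -> (r ||- z \in s <->
    r ||- (z \in t /\ \ex x \in a, \ex y, is_pair z x y))).
  { intros r z L'. fspec H z. rewrite frc_iff in H. auto. }
  clear H.
  fwit b. fsplit; [|fsplit; [exact S|]].
  - rewrite frc_ordinal in O, Oa |- *. destruct O as [O1 O2], Oa as [A1 _]. split.
    + intros r y z L' Hy Hz. apply Hb in Hy as [Hy1 Hy2]. apply Hb. split; eauto.
    + intros r y z L' Hy Hz. apply Hb in Hy as [Hy1 Hy2]. apply Hb in Hz as [Hz1 Hz2]. eauto.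
  - assert (St : q ||- subset s t).
    { apply frc_subset. intros r z L'. rewrite (Hs r z L'), frc_and. tauto. }
    apply fun_on_intro.
    + intros r z L' Hz. down L'. rewrite (Hs r z L'), frc_and in Hz. destruct Hz as [Hz K].
      fex K as x K. fand K as [Hx K]. fex K as y K.
      fwit x. fsplit; [|fwit y; exact K]. apply Hb. split; [|exact Hx].
      eapply fun_on_dom; [exact F|]. eapply maps_intro; eassumption.
    + intros r x L' Hx. down L'. apply Hb in Hx as [Hd Ha].
      pose proof (fun_on_total _ _ _ _ F Hd) as K. fex K as y K. fwit y.
      unfold maps in K |- *. fex K as z K. fwit z. fand K as [Kz K].
      fsplit; [|exact K]. rewrite Hs; [|assumption].
      fsplit; [exact Kz|]. fwit x. fsplit; [exact Ha|]. fwit y. exact K.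
    + intros r x y y' L' H1 H2. down L'.
      apply (fun_on_fun _ _ _ x _ _ F); eauto using maps_subset.
Qed.

(** The domain [b] of [s] serves as the cutting ordinal: an element of [t] with argument in [b]
    carries the value that [s] takes there, as [t] is a function, and so lies in [s]. *)
Lemma subset_init_seg p s t b d : p ||- fun_on s b -> p ||- ordinal b -> p ||- fun_on t d ->
  p ||- subset s t -> p ||- init_seg s t.
Proof.
  intros Fs O Ft S. unfold init_seg. fwit b. fsplit; [exact O|]. fall z.
  apply frc_iff. intros q L. down L. split.
  - intros Hz. fsplit; [eapply subset_mem; eassumption|].
    pose proof Fs as F. unfold fun_on in F. fand F as [F [_ _]]. fspec F z.
    apply (frc_mp _ _ _ F Hz).
  - intros H. fand H as [Hz H]. fex H as x H. fand H as [Hx H]. fex H as y H.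
    pose proof (fun_on_total _ _ _ _ Fs Hx) as K. fex K as y' K.
    apply (maps_mem _ _ _ x y); [|exact H].
    assert (E : q2 ||- y == y').
    { apply (fun_on_fun _ _ _ x _ _ Ft); [eapply maps_intro; eassumption|].
      eauto using maps_subset. }
    frw E. exact K.
Qed.

(** Separation forms the restriction before anything is known about [t], so one [s] serves all
    worlds and all [d] at once. *)
Lemma restriction_exists t b : exists s, forall p d,
  p ||- fun_on t d -> p ||- subset b d -> p ||- fun_on s b /\ p ||- subset s t.
Proof.
  destruct (frc_separation _ M (fun z => \ex x \in b, \ex y, is_pair z x y)%form) with t
    as [s Hs].
  { change (congruent (M:=M) (fun z => \ex x \in b, \ex y, is_pair z x y)%form). congr_tac. }
  exists s. intros p d F S.
  assert (St : p ||- subset s t).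
  { apply frc_subset. intros r z L. rewrite Hs. tauto. }
  split; [|exact St]. apply fun_on_intro.
  - intros q z L Hz. apply Hs in Hz. tauto.
  - intros q x L Hx. down L.
    pose proof (fun_on_total _ _ _ _ F (subset_mem _ _ _ _ S Hx)) as K. fex K as y K.
    fwit y. unfold maps in K |- *. fex K as z K. fand K as [Kz K]. fwit z.
    fsplit; [|exact K]. apply Hs. split; [exact Kz|].
    fwit x. fsplit; [exact Hx|]. fwit y. exact K.
  - intros q x y y' L H1 H2. down L.
    apply (fun_on_fun _ _ _ x _ _ F); eauto using maps_subset.
Qed.

End Functions.

(** * Extensional equality and membership of well-founded sets *)

Lemma Veq_refl x : Veq x x.
Proof. induction x as [A f IH]; simpl; split; intros a; exists a; apply IH. Qed.

Lemma Veq_sym x y : Veq x y -> Veq y x.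
Proof.
  revert y. induction x as [A f IH]; intros [B g] [H K]; simpl; split.
  - intros b. destruct (K b) as [a Ha]. eauto.
  - intros a. destruct (H a) as [b Hb]. eauto.
Qed.

Lemma Veq_trans x y z : Veq x y -> Veq y z -> Veq x z.
Proof.
  revert y z. induction x as [A f IH]; intros [B g] [C h] [H K] [H' K']; simpl; split.
  - intros a. destruct (H a) as [b Hb]. destruct (H' b) as [c Hc]. eauto.
  - intros c. destruct (K' c) as [b Hb]. destruct (K b) as [a Ha]. eauto.
Qed.

#[export] Instance Veq_equivalence : Equivalence Veq.
Proof. split; [exact Veq_refl|exact Veq_sym|exact Veq_trans]. Qed.

Lemma Vmem_l x y z : Veq x y -> Vmem x z -> Vmem y z.
Proof. destruct z as [C h]. intros E [c Hc]. exists c. rewrite <- E. exact Hc. Qed.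

Lemma Vmem_r x y z : Veq y z -> Vmem x y -> Vmem x z.
Proof.
  destruct y as [B g], z as [C h]. intros [H _] [b Hb]. destruct (H b) as [c Hc].
  exists c. rewrite Hb. exact Hc.
Qed.

#[export] Instance Vmem_proper : Proper (Veq ==> Veq ==> iff) Vmem.
Proof.
  intros x x' Ex y y' Ey. split; intros H.
  - apply (Vmem_l x); [exact Ex|]. apply (Vmem_r _ y); assumption.
  - apply (Vmem_l x'); [symmetry; exact Ex|]. apply (Vmem_r _ y'); [symmetry|]; assumption.
Qed.

Lemma Vext x y : (forall z, Vmem z x <-> Vmem z y) -> Veq x y.
Proof.
  destruct x as [A f], y as [B g]. intros H. simpl. split.
  - intros a. apply (H (f a)). exists a. reflexivity.
  - intros b. destruct (proj2 (H (g b))) as [a Ha]; [exists b; reflexivity|].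
    exists a. symmetry. exact Ha.
Qed.

Lemma Vmem_wf : well_founded Vmem.
Proof.
  intros x. induction x as [A f IH]. constructor. intros y [a Ha].
  specialize (IH a). constructor. intros z Hz. rewrite Ha in Hz. apply IH, Hz.
Qed.

Lemma Vmem_irrefl x : ~ Vmem x x.
Proof. induction x as [x IH] using (well_founded_ind Vmem_wf). intros H. exact (IH x H H). Qed.

Lemma Vmem_asym x y : Vmem x y -> ~ Vmem y x.
Proof.
  revert y. induction x as [x IH] using (well_founded_ind Vmem_wf).
  intros y Hxy Hyx. exact (IH y Hyx x Hyx Hxy).
Qed.

Lemma Vmem_acyclic3 x y z : Vmem x y -> Vmem y z -> ~ Vmem z x.
Proof.
  revert y z. induction x as [x IH] using (well_founded_ind Vmem_wf).
  intros y z Hxy Hyz Hzx. exact (IH z Hzx x y Hzx Hxy Hyz).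
Qed.

Lemma Vmem_minimal (Q : V -> Prop) : (exists x, Q x) ->
  exists x, Q x /\ forall y, Vmem y x -> ~ Q y.
Proof.
  intros [x Hx]. apply NNPP. intros N. revert Hx.
  induction x as [x IH] using (well_founded_ind Vmem_wf). intros Hx.
  apply N. exists x. split; [exact Hx|]. intros y Hy Qy. exact (IH y Hy Qy).
Qed.

(** * Set constructions *)

Definition Vcarrier (x : V) : U := match x with Vset A _ => A end.
Definition Vfam (x : V) : Vcarrier x -> V :=
  match x with Vset A f => f end.

Lemma Vmem_fam x z : Vmem z x <-> exists a, Veq z (Vfam x a).
Proof. destruct x; reflexivity. Qed.

Lemma Vfam_mem x a : Vmem (Vfam x a) x.
Proof. apply Vmem_fam. exists a. reflexivity. Qed.

Definition Vrepl (x : V) (g : V -> V) : V := Vset (Vcarrier x) (fun a => g (Vfam x a)).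
Definition Vsep (x : V) (Q : V -> Prop) : V :=
  Vset {a : Vcarrier x | Q (Vfam x a)} (fun a => Vfam x (proj1_sig a)).
(** Subsets are indexed by predicates on the index type of [x], which keeps the power set within the
    universe of index types. *)
Definition Vpow (x : V) : V :=
  Vset (Vcarrier x -> Prop) (fun X => Vset {a | X a} (fun a => Vfam x (proj1_sig a))).
Definition Vpair (x y : V) : V := Vset bool (fun b => if b then x else y).
Definition opair (x y : V) : V := Vpair (Vpair x x) (Vpair x y).
Definition Vsucc (x : V) : V :=
  Vset (option (Vcarrier x)) (fun o => match o with Some a => Vfam x a | None => x end).
Definition Vprod (x y : V) : V :=
  Vset (Vcarrier x * Vcarrier y)%type (fun c => opair (Vfam x (fst c)) (Vfam y (snd c))).

Definition Vsub (x y : V) : Prop := forall z, Vmem z x -> Vmem z y.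
Definition Vcongr (Q : V -> Prop) : Prop := forall x y, Veq x y -> Q x -> Q y.

#[export] Instance Vsub_proper : Proper (Veq ==> Veq ==> iff) Vsub.
Proof.
  intros x x' Ex y y' Ey. unfold Vsub. split; intros H z.
  - rewrite <- Ex, <- Ey. auto.
  - rewrite Ex, Ey. auto.
Qed.

Lemma Vsub_antisym x y : Vsub x y -> Vsub y x -> Veq x y.
Proof. intros H K. apply Vext. split; auto. Qed.

Lemma Vmem_sep x Q z : Vcongr Q -> (Vmem z (Vsep x Q) <-> Vmem z x /\ Q z).
Proof.
  intros C. split.
  - intros [[a Ha] Hz]. simpl in Hz. split; [rewrite Hz; apply Vfam_mem|].
    apply (C (Vfam x a)); [symmetry; exact Hz|exact Ha].
  - intros [Hz HQ]. apply Vmem_fam in Hz as [a Ha]. exists (exist _ a (C _ _ Ha HQ)). exact Ha.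
Qed.

Lemma Vmem_pow x z : Vmem z (Vpow x) <-> Vsub z x.
Proof.
  split.
  - intros [X HX] w. rewrite HX. intros [[a Ha] Hw]. simpl in Hw. rewrite Hw. apply Vfam_mem.
  - intros H. exists (fun a => Vmem (Vfam x a) z). apply Vext. intros w. split.
    + intros Hw. pose proof (H w Hw) as K. apply Vmem_fam in K as [a Ha].
      rewrite Ha in Hw. exists (exist _ a Hw). exact Ha.
    + intros [[a Ha] Hw]. simpl in Hw. rewrite Hw. exact Ha.
Qed.

Lemma Vmem_pair x y z : Vmem z (Vpair x y) <-> Veq z x \/ Veq z y.
Proof.
  split.
  - intros [[] H]; auto.
  - intros [H|H]; [exists true|exists false]; exact H.
Qed.

Lemma Vmem_succ x z : Vmem z (Vsucc x) <-> Vmem z x \/ Veq z x.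
Proof.
  split.
  - intros [[a|] H]; [left|right; exact H]. rewrite H. apply Vfam_mem.
  - intros [H|H]; [|exists None; exact H]. apply Vmem_fam in H as [a Ha]. exists (Some a). exact Ha.
Qed.

#[export] Instance Vsucc_proper : Proper (Veq ==> Veq) Vsucc.
Proof. intros x y E. apply Vext. intros z. rewrite !Vmem_succ, E. reflexivity. Qed.

#[export] Instance Vpair_proper : Proper (Veq ==> Veq ==> Veq) Vpair.
Proof. intros x y E x' y' E'. apply Vext. intros z. rewrite !Vmem_pair, E, E'. reflexivity. Qed.

#[export] Instance opair_proper : Proper (Veq ==> Veq ==> Veq) opair.
Proof. intros x y E x' y' E'. unfold opair. rewrite E, E'. reflexivity. Qed.

(** * The ground model *)

Lemma sat_imp a b : sat (Imp a b) <-> (sat a -> sat b).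
Proof. simpl. tauto. Qed.
Lemma sat_or a b : sat (Or a b) <-> (sat a \/ sat b).
Proof. simpl. tauto. Qed.
Lemma sat_iff a b : sat (Iff a b) <-> (sat a <-> sat b).
Proof. simpl. tauto. Qed.
Lemma sat_ex f : sat (Ex f) <-> exists x, sat (f x).
Proof.
  simpl. split; [|firstorder]. intros H. apply NNPP. intros N. apply H. intros x Hx. eauto.
Qed.

Definition ground : model V.
Proof.
  refine (Model V unit (fun _ _ => True) (fun _ a => sat a) _ _ _ _ _ _ _ _ _ _ _ _ _ _ _ _).
  - tauto.
  - tauto.
  - tauto.
  - intros p a H. destruct (H tt I) as (_ & _ & K). exact K.
  - reflexivity.
  - intros p a. simpl. split; [auto|]. intros H. exact (H tt I).
  - reflexivity.
  - reflexivity.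
  - intros _. exact Veq_refl.
  - intros _. exact Veq_sym.
  - intros _. exact Veq_trans.
  - intros _. exact Vmem_l.
  - intros _. exact Vmem_r.
  - intros _ x y H. apply Vext. intros z. exact (H tt z I).
  - intros a b. exists (Vpair a b). intros _ w. rewrite sat_or. apply Vmem_pair.
  - intros phi C t. exists (Vsep t (fun z => sat (phi z))). intros _ z.
    apply Vmem_sep. intros x y. exact (C tt x y).
Defined.

Lemma ground_frc (p : world ground) a : p ||- a <-> sat a.
Proof. reflexivity. Qed.

Lemma sat_subset x y : sat (subset x y) <-> Vsub x y.
Proof. unfold subset, Vsub. simpl. split; intros H z; specialize (H z); tauto. Qed.

Lemma sat_upair z a b : sat (is_upair z a b) <-> Veq z (Vpair a b).
Proof.
  unfold is_upair. split.
  - intros H. apply Vext. intros w. rewrite Vmem_pair. specialize (H w).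
    rewrite sat_iff, sat_or in H. exact H.
  - intros H w. rewrite sat_iff, sat_or. simpl. rewrite H. apply Vmem_pair.
Qed.

Lemma sat_pair z a b : sat (is_pair z a b) <-> Veq z (opair a b).
Proof.
  unfold is_pair. rewrite sat_ex. split.
  - intros [u Hu]. rewrite sat_ex in Hu. destruct Hu as [v (Hu & Hv & Hz)].
    rewrite sat_upair in Hu, Hv, Hz. rewrite Hz, Hu, Hv. reflexivity.
  - intros H. exists (Vpair a a). rewrite sat_ex. exists (Vpair a b).
    split; [|split]; apply sat_upair; try reflexivity. exact H.
Qed.

Lemma opair_inj a b c d : Veq (opair a b) (opair c d) -> Veq a c /\ Veq b d.
Proof.
  intros H. split.
  - refine (pair_inj_l (M := ground) tt (opair a b) a b c d _ _); apply sat_pair;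
      [reflexivity|exact H].
  - refine (pair_inj_r (M := ground) tt (opair a b) a b c d _ _); apply sat_pair;
      [reflexivity|exact H].
Qed.

Lemma sat_maps f a b : sat (maps f a b) <-> Vmem (opair a b) f.
Proof.
  unfold maps. rewrite sat_ex. split.
  - intros [z [Hz Hp]]. rewrite sat_pair in Hp. simpl in Hz. rewrite <- Hp. exact Hz.
  - intros H. exists (opair a b). split; [exact H|]. apply sat_pair. reflexivity.
Qed.

Lemma sat_fun_on f d : sat (fun_on f d) <->
  (forall z, Vmem z f -> exists a b, Vmem a d /\ Veq z (opair a b)) /\
  (forall a, Vmem a d -> exists b, Vmem (opair a b) f) /\
  (forall a b c, Vmem (opair a b) f -> Vmem (opair a c) f -> Veq b c).
Proof.
  unfold fun_on. cbn [sat]. split.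
  - intros (H1 & H2 & H3). split; [|split].
    + intros z Hz. specialize (H1 z). rewrite sat_imp, sat_ex in H1.
      destruct (H1 Hz) as [a [Ha Hb]]. rewrite sat_ex in Hb. destruct Hb as [b Hb].
      apply sat_pair in Hb. eauto.
    + intros a Ha. specialize (H2 a). rewrite sat_imp, sat_ex in H2.
      destruct (H2 Ha) as [b Hb]. apply sat_maps in Hb. eauto.
    + intros a b c Hb Hc. specialize (H3 a b c). rewrite sat_imp in H3.
      apply H3. split; apply sat_maps; assumption.
  - intros (H1 & H2 & H3). split; [|split].
    + intros z. rewrite sat_imp. intros Hz. destruct (H1 z Hz) as (a & b & Ha & E).
      apply sat_ex. exists a. split; [exact Ha|]. apply sat_ex. exists b. apply sat_pair, E.
    + intros a. rewrite sat_imp. intros Ha. destruct (H2 a Ha) as [b Hb].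
      apply sat_ex. exists b. apply sat_maps, Hb.
    + intros a b c. rewrite sat_imp. intros [Hb Hc]. rewrite sat_maps in Hb, Hc.
      apply (H3 a); assumption.
Qed.

Lemma sat_fun_from_to f d c : sat (fun_from_to f d c) <->
  sat (fun_on f d) /\ forall a b, Vmem (opair a b) f -> Vmem b c.
Proof.
  unfold fun_from_to. cbn [sat]. split; intros [H K]; (split; [exact H|]); intros a b.
  - specialize (K a b). rewrite sat_imp, sat_maps in K. exact K.
  - rewrite sat_imp, sat_maps. apply K.
Qed.

(** A meta-level function acts on representatives; respecting [Veq] on [x] is what makes its graph
    [fset x g] single-valued. *)
Definition ext_on (x : V) (g : V -> V) : Prop :=
  forall a b, Vmem a x -> Veq a b -> Veq (g a) (g b).

Definition fset (x : V) (g : V -> V) : V := Vrepl x (fun a => opair a (g a)).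

Lemma fset_opair x g a b : ext_on x g ->
  (Vmem (opair a b) (fset x g) <-> Vmem a x /\ Veq b (g a)).
Proof.
  intros E. split.
  - intros [i Hi]. apply opair_inj in Hi as [H1 H2].
    assert (Vmem a x) by (rewrite H1; apply Vfam_mem). split; [assumption|].
    rewrite H2. symmetry. apply E; assumption.
  - intros [Ha Hb]. pose proof Ha as K. apply Vmem_fam in K as [i Hi]. exists i.
    cbv beta. rewrite Hb, (E a (Vfam x i) Ha Hi). apply opair_proper; [exact Hi|reflexivity].
Qed.

Lemma fset_elem x g z : Vmem z (fset x g) -> exists a, Vmem a x /\ Veq z (opair a (g a)).
Proof. intros [i Hi]. exists (Vfam x i). split; [apply Vfam_mem|exact Hi]. Qed.

Lemma fset_fun_on x g : ext_on x g -> sat (fun_on (fset x g) x).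
Proof.
  intros E. apply sat_fun_on. split; [|split].
  - intros z Hz. apply fset_elem in Hz as (a & Ha & H). eauto.
  - intros a Ha. exists (g a). apply fset_opair; [exact E|]. split; [exact Ha|reflexivity].
  - intros a b c Hb Hc. apply fset_opair in Hb as [_ Hb]; [|exact E].
    apply fset_opair in Hc as [_ Hc]; [|exact E]. rewrite Hb, Hc. reflexivity.
Qed.

Lemma fset_fun_from_to x y g : ext_on x g -> (forall a, Vmem a x -> Vmem (g a) y) ->
  sat (fun_from_to (fset x g) x y).
Proof.
  intros E H. apply sat_fun_from_to. split; [apply fset_fun_on, E|].
  intros a b K. apply fset_opair in K as [Ha Hb]; [|exact E]. rewrite Hb. auto.
Qed.

Definition inj (x y : V) : Prop := exists g, ext_on x g /\
  (forall a, Vmem a x -> Vmem (g a) y) /\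
  (forall a b, Vmem a x -> Vmem b x -> Veq (g a) (g b) -> Veq a b).

(** Choice reads a function off its graph. The values chosen at [Veq] arguments may be different
    representatives, but single-valuedness of the graph makes them [Veq]. *)
Lemma sat_injects x y : sat (injects x y) <-> inj x y.
Proof.
  unfold injects. rewrite sat_ex. split.
  - intros [f [F H]]. apply sat_fun_from_to in F as [F Fy].
    apply sat_fun_on in F as (F1 & F2 & F3).
    exists (fun a => epsilon (inhabits x) (fun b => Vmem (opair a b) f)).
    assert (K : forall a, Vmem a x ->
      Vmem (opair a (epsilon (inhabits x) (fun b => Vmem (opair a b) f))) f).
    { intros a Ha. apply epsilon_spec. auto. }
    split; [|split].
    + intros a b Ha E. apply (F3 a); [apply K, Ha|]. rewrite E at 1.
      apply K. rewrite <- E. exact Ha.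
    + intros a Ha. apply (Fy a). auto.
    + intros a b Ha Hb E. specialize (H a b (epsilon (inhabits x) (fun c => Vmem (opair a c) f))).
      rewrite sat_imp in H. apply H. split; apply sat_maps; [apply K, Ha|].
      rewrite E. apply K, Hb.
  - intros (g & E & Hy & Hi). exists (fset x g). split; [apply fset_fun_from_to; assumption|].
    intros a b c. rewrite sat_imp. cbn [sat]. rewrite !sat_maps. intros [Ha Hb].
    apply fset_opair in Ha as [Ha Ea]; [|exact E]. apply fset_opair in Hb as [Hb Eb]; [|exact E].
    apply Hi; [assumption..|]. rewrite <- Ea. exact Eb.
Qed.

Lemma inj_sub x y : Vsub x y -> inj x y.
Proof. intros H. exists (fun a => a). split; [|split]; [intros a b _ E; exact E|exact H|auto]. Qed.

Lemma inj_trans x y z : inj x y -> inj y z -> inj x z.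
Proof.
  intros (g & Eg & Hg & Ig) (h & Eh & Hh & Ih). exists (fun a => h (g a)). split; [|split].
  - intros a b Ha E. apply Eh; auto.
  - auto.
  - intros a b Ha Hb E. apply Ig; [assumption..|]. apply Ih; auto.
Qed.

(** Subsets of [x] go to their images under [g], from which injectivity recovers them. *)
Lemma inj_pow x y : inj x y -> inj (Vpow x) (Vpow y).
Proof.
  intros (g & Eg & Hg & Ig).
  assert (C : forall z, Vcongr (fun b => exists a, Vmem a x /\ Vmem a z /\ Veq b (g a))).
  { intros z b b' E (a & H & K & L). exists a. rewrite <- E. auto. }
  exists (fun z => Vsep y (fun b => exists a, Vmem a x /\ Vmem a z /\ Veq b (g a))).
  split; [|split].
  - intros z z' _ E. apply Vext. intros w. rewrite !Vmem_sep by apply C.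
    split; intros [H (a & K)]; (split; [exact H|]); exists a; [rewrite <- E|rewrite E]; exact K.
  - intros z _. apply Vmem_pow. intros w. rewrite Vmem_sep by apply C. tauto.
  - intros z z' Hz Hz' E. apply Vmem_pow in Hz, Hz'.
    assert (K : forall u v, Vsub u x -> Vsub v x ->
       Veq (Vsep y (fun b => exists a, Vmem a x /\ Vmem a u /\ Veq b (g a)))
           (Vsep y (fun b => exists a, Vmem a x /\ Vmem a v /\ Veq b (g a))) -> Vsub u v).
    { intros u v Hu Hv Euv a Ha.
      assert (L : Vmem (g a) (Vsep y (fun b => exists a, Vmem a x /\ Vmem a u /\ Veq b (g a)))).
      { apply Vmem_sep; [apply C|]. split; [auto|]. exists a. repeat split; auto. reflexivity. }
      rewrite Euv in L. apply Vmem_sep in L as [_ (a' & H1 & H2 & H3)]; [|apply C].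
      rewrite (Ig a a'); auto. }
    apply Vsub_antisym; apply K; auto. symmetry. exact E.
Qed.

(** * Ordinals of the ground model *)

Definition transitive_set (x : V) : Prop := forall y z, Vmem y x -> Vmem z y -> Vmem z x.
Definition Ord (x : V) : Prop := transitive_set x /\
  forall y z, Vmem y x -> Vmem z x -> Vmem y z \/ Veq y z \/ Vmem z y.

Lemma sat_ordinal x : sat (ordinal x) <-> Ord x.
Proof.
  rewrite <- (ground_frc tt). rewrite frc_ordinal. split; intros [H K]; split.
  - intros y z. exact (H tt y z I).
  - intros y z Hy Hz. specialize (K tt y z I Hy Hz). rewrite ground_frc, !sat_or in K. exact K.
  - intros q y z _. exact (H y z).
  - intros q y z _ Hy Hz. rewrite ground_frc, !sat_or. exact (K y z Hy Hz).
Qed.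

Lemma Ord_mem x y : Ord x -> Vmem y x -> Ord y.
Proof.
  intros [T L] Hy. split.
  - intros z w Hz Hw. assert (Hzx := T _ _ Hy Hz). assert (Hwx := T _ _ Hzx Hw).
    destruct (L _ _ Hwx Hy) as [H|[H|H]]; [exact H|exfalso..].
    + rewrite H in Hw. exact (Vmem_asym _ _ Hz Hw).
    + exact (Vmem_acyclic3 _ _ _ H Hw Hz).
  - intros z w Hz Hw. apply L; eapply T; eassumption.
Qed.

(** Unless [y] is all of [x], a membership-minimal element of [x] outside [y] turns out to be equal
    to [y]. *)
Lemma transitive_subset x y : Ord x -> transitive_set y -> Vsub y x -> Vmem y x \/ Veq y x.
Proof.
  intros [T L] Ty S. destruct (classic (Vsub x y)) as [S'|N].
  { right. apply Vsub_antisym; assumption. }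
  left. destruct (Vmem_minimal (fun z => Vmem z x /\ ~ Vmem z y)) as (z & [Hz Nz] & Hmin).
  { apply NNPP. intros K. apply N. intros z Hz. apply NNPP. eauto. }
  assert (E : Veq y z).
  { apply Vext. intros w. split; intros Hw.
    - destruct (L _ _ (S _ Hw) Hz) as [H|[H|H]]; [exact H|exfalso; apply Nz..].
      + rewrite <- H. exact Hw.
      + exact (Ty _ _ Hw H).
    - apply NNPP. intros K. apply (Hmin w Hw). split; [exact (T _ _ Hz Hw)|exact K]. }
  rewrite E. exact Hz.
Qed.

Lemma Ord_sub_mem x y z : Ord z -> Vmem y z -> Ord x -> Vsub x y -> Vmem x z.
Proof.
  intros Oz Hy Ox S. pose proof (Ord_mem _ _ Oz Hy) as Oy.
  destruct (transitive_subset y x Oy (proj1 Ox) S) as [H|H].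
  - exact (proj1 Oz _ _ Hy H).
  - rewrite H. exact Hy.
Qed.

(** * Cardinal arithmetic below an inaccessible *)

Lemma sat_power p x : sat (is_power p x) <-> forall z, Vmem z p <-> Vsub z x.
Proof.
  unfold is_power. cbn [sat]. split; intros H z; specialize (H z);
    rewrite sat_iff, sat_subset in *; exact H.
Qed.

Section Inaccessible.
Variable kappa : V.
Hypothesis h_kappa : sat (inaccessible kappa).

Lemma kappa_ord : Ord kappa.
Proof. apply sat_ordinal. exact (proj1 h_kappa). Qed.

Lemma kappa_trans a b : Vmem a kappa -> Vmem b a -> Vmem b kappa.
Proof. exact (proj1 kappa_ord a b). Qed.

Lemma kappa_card a : Vmem a kappa -> ~ inj kappa a.
Proof.
  intros Ha. destruct h_kappa as (_ & H & _). specialize (H a). rewrite sat_imp in H.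
  destruct (H Ha) as [_ K]. rewrite <- sat_injects. exact K.
Qed.

Lemma kappa_regular a g : Vmem a kappa -> ext_on a g ->
  (forall x, Vmem x a -> Vmem (g x) kappa) ->
  exists b, Vmem b kappa /\ forall x, Vmem x a -> Vmem (g x) b.
Proof.
  intros Ha E H. destruct h_kappa as (_ & _ & _ & K & _). specialize (K a).
  rewrite sat_imp in K. specialize (K Ha (fset a g)). rewrite sat_imp in K.
  specialize (K (fset_fun_from_to _ _ _ E H)). rewrite sat_ex in K. destruct K as [b [Hb K]].
  exists b. split; [exact Hb|]. intros x Hx. specialize (K x (g x)). rewrite sat_imp, sat_maps in K.
  apply K, fset_opair; [exact E|]. split; [exact Hx|reflexivity].
Qed.

Lemma kappa_strong_limit a : Vmem a kappa -> inj (Vpow a) kappa /\ ~ inj kappa (Vpow a).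
Proof.
  intros Ha. destruct h_kappa as (_ & _ & _ & _ & K). specialize (K a).
  rewrite sat_imp in K. specialize (K Ha (Vpow a)). rewrite sat_imp in K.
  destruct K as [H N]; [apply sat_power, Vmem_pow|].
  split; rewrite <- sat_injects; assumption.
Qed.

(** The injection of omega into [kappa] sends zero and one to different ordinals, one of which is
    then an element of the other. *)
Lemma kappa_nonempty_mem : exists a b, Vmem a kappa /\ Vmem b a.
Proof.
  destruct h_kappa as (_ & _ & H & _). rewrite sat_ex in H.
  destruct H as [w [[[He Hs] _] [Hw _]]]. rewrite sat_ex in He. destruct He as [e [He Ne]].
  specialize (Hs e). rewrite sat_imp, sat_ex in Hs. destruct (Hs He) as [s [Hsw Es]].
  apply sat_injects in Hw as (g & _ & Hg & Ig).
  assert (Hes : Vmem e s).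
  { specialize (Es e). rewrite sat_iff, sat_or in Es. apply Es. right. apply Veq_refl. }
  destruct (proj2 kappa_ord (g e) (g s)) as [H|[H|H]]; eauto.
  exfalso. apply Ig in H; [|assumption..]. rewrite <- H in Hes. exact (Vmem_irrefl _ Hes).
Qed.

(** Regularity is applied to the constant function with value [a] on a nonempty ordinal: any bound
    of it lies above [a]. *)
Lemma kappa_limit a : Vmem a kappa -> exists b, Vmem b kappa /\ Vmem a b.
Proof.
  intros Ha. destruct kappa_nonempty_mem as (d & c & Hd & Hc).
  destruct (kappa_regular d (fun _ => a) Hd) as (b & Hb & K).
  - intros x y _ _. reflexivity.
  - auto.
  - eauto.
Qed.

Lemma kappa_Ord a : Vmem a kappa -> Ord a.
Proof. apply Ord_mem, kappa_ord. Qed.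

Lemma Vsucc_Ord a : Ord a -> Ord (Vsucc a).
Proof.
  intros [T L]. split.
  - intros y z. rewrite !Vmem_succ. intros [H|H] K; [left; eauto|left; rewrite <- H; exact K].
  - intros y z. rewrite !Vmem_succ. intros [H|H] [K|K].
    + auto.
    + left. rewrite K. exact H.
    + right; right. rewrite H. exact K.
    + right; left. rewrite H, K. reflexivity.
Qed.

Lemma kappa_succ a : Vmem a kappa -> Vmem (Vsucc a) kappa.
Proof.
  intros Ha. destruct (kappa_limit a Ha) as (b & Hb & Hab).
  apply (Ord_sub_mem _ b); [exact kappa_ord|exact Hb|apply Vsucc_Ord, kappa_Ord, Ha|].
  intros z. rewrite Vmem_succ. intros [H|H]; [|rewrite H; exact Hab].
  exact (proj1 (kappa_Ord _ Hb) _ _ Hab H).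
Qed.

Lemma kappa_compare a b : Vmem a kappa -> Vmem b kappa -> Vsub a b \/ Vmem b a.
Proof.
  intros Ha Hb. destruct (proj2 kappa_ord a b Ha Hb) as [H|[H|H]]; auto; left.
  - intros z Hz. exact (proj1 (kappa_Ord _ Hb) _ _ H Hz).
  - rewrite H. intros z; auto.
Qed.

Lemma mem_Vsub a b : Vmem b kappa -> Vmem a b -> Vsub a b.
Proof. intros Hb Ha z Hz. exact (proj1 (kappa_Ord _ Hb) _ _ Ha Hz). Qed.

Lemma succ_Vsub a b : Vmem b kappa -> Vmem a b -> Vsub (Vsucc a) b.
Proof.
  intros Hb Ha z. rewrite Vmem_succ. intros [H|H]; [|rewrite H; exact Ha].
  exact (mem_Vsub _ _ Hb Ha z H).
Qed.

(* The injection picks, by recursion on [xi], an element of [y] not used before;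
   one exists since the [g]-values of the used ones are bounded by regularity. *)
Lemma unbounded_inj y g : ext_on y g -> (forall a, Vmem a y -> Vmem (g a) kappa) ->
  (forall b, Vmem b kappa -> exists a, Vmem a y /\ ~ Vmem (g a) b) ->
  inj kappa y.
Proof.
  intros Eg Hg Hunb.
  set (h := Fix Vmem_wf (fun _ => V) (fun xi rec =>
    epsilon (inhabits kappa)
      (fun a => Vmem a y /\ forall z (Hz : Vmem z xi), ~ Veq a (rec z Hz)))).
  assert (h_eq : forall xi, h xi = epsilon (inhabits kappa)
      (fun a => Vmem a y /\ forall z, Vmem z xi -> ~ Veq a (h z))).
  { intros xi. unfold h at 1. rewrite Fix_eq; [reflexivity|].
    intros x f f' E. replace f' with f; [reflexivity|].
    extensionality z. extensionality Hz. apply E. }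
  (* For [Veq] arguments the defining predicates are equal, so [epsilon] returns literally the same
     set. *)
  assert (h_ext : forall a b, Veq a b -> h a = h b).
  { intros a b E. rewrite (h_eq a), (h_eq b). f_equal. extensionality c.
    apply propositional_extensionality. split; intros [H K]; (split; [exact H|]); intros z Hz;
      apply K; [rewrite E|rewrite <- E]; exact Hz. }
  assert (h_spec : forall xi, Vmem xi kappa ->
    Vmem (h xi) y /\ forall z, Vmem z xi -> ~ Veq (h xi) (h z)).
  { intros xi. induction xi as [xi IH] using (well_founded_ind Vmem_wf). intros Hxi.
    rewrite h_eq. apply epsilon_spec.
    assert (Hy : forall z, Vmem z xi -> Vmem (h z) y).
    { intros z Hz. apply IH; [exact Hz|]. exact (kappa_trans _ _ Hxi Hz). }
    destruct (kappa_regular xi (fun z => g (h z)) Hxi) as (b & Hb & K).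
    - intros z z' Hz E. rewrite (h_ext z z' E). reflexivity.
    - intros z Hz. auto.
    - destruct (Hunb b Hb) as (a & Ha & Na). exists a. split; [exact Ha|].
      intros z Hz E. apply Na. rewrite (Eg a (h z)); auto. }
  exists h. split; [|split].
  - intros a b _ E. rewrite (h_ext a b E). reflexivity.
  - intros a Ha. apply h_spec, Ha.
  - intros a b Ha Hb E. destruct (proj2 kappa_ord a b Ha Hb) as [H|[H|H]]; [exfalso|exact H|exfalso].
    + symmetry in E. exact (proj2 (h_spec b Hb) a H E).
    + exact (proj2 (h_spec a Ha) b H E).
Qed.

(** Cardinality below [kappa] with an explicit bounding ordinal; [small_iff] shows the agreement
    with [card_lt]. *)
Definition small (y : V) : Prop := exists a, Vmem a kappa /\ inj y a.

(** An injection of [y] into [kappa] is either bounded, which is smallness, or unbounded, and then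
    [unbounded_inj] embeds [kappa] into [y]. *)
Lemma inj_kappa_small y : inj y kappa -> ~ inj kappa y -> small y.
Proof.
  intros (g & Eg & Hg & Ig) N. apply NNPP. intros K. apply N.
  apply (unbounded_inj y g Eg Hg). intros b Hb. apply NNPP. intros L. apply K.
  exists b. split; [exact Hb|]. exists g. split; [exact Eg|split; [|exact Ig]].
  intros a Ha. apply NNPP. eauto.
Qed.

Lemma small_iff y : small y <-> sat (card_lt y kappa).
Proof.
  unfold card_lt. cbn [sat]. rewrite !sat_injects. split.
  - intros (a & Ha & H). split.
    + eapply inj_trans; [exact H|]. apply inj_sub. intros z. apply kappa_trans, Ha.
    + intros K. apply (kappa_card a Ha). eapply inj_trans; eassumption.
  - intros [H N]. apply inj_kappa_small; assumption.
Qed.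

Lemma small_inj x y : inj x y -> small y -> small x.
Proof. intros H (a & Ha & K). exists a. split; [exact Ha|]. eapply inj_trans; eassumption. Qed.

Lemma small_pow y : small y -> small (Vpow y).
Proof.
  intros (a & Ha & H). apply (small_inj _ (Vpow a)); [apply inj_pow, H|].
  destruct (kappa_strong_limit a Ha). apply inj_kappa_small; assumption.
Qed.

Lemma small_mem a : Vmem a kappa -> small a.
Proof. intros Ha. exists a. split; [exact Ha|]. apply inj_sub. intros z; auto. Qed.

Lemma Vmem_prod x y z : Vmem z (Vprod x y) <->
  exists a b, Vmem a x /\ Vmem b y /\ Veq z (opair a b).
Proof.
  split.
  - intros [[i j] H]. exists (Vfam x i), (Vfam y j). split; [apply Vfam_mem|].
    split; [apply Vfam_mem|exact H].
  - intros (a & b & Ha & Hb & H). apply Vmem_fam in Ha as [i Hi]. apply Vmem_fam in Hb as [j Hj].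
    exists (i, j). simpl. rewrite H, Hi, Hj. reflexivity.
Qed.

(** Cardinal multiplication is avoided: when both factors inject into one ordinal [m], the
    Kuratowski pairs of images are elements of the double power set of [m], which is small because
    [kappa] is a strong limit. *)
Lemma small_prod x y : small x -> small y -> small (Vprod x y).
Proof.
  intros (a & Ha & (g & Eg & Hg & Ig)) (b & Hb & (h & Eh & Hh & Ih)).
  assert (exists m, Vmem m kappa /\ Vsub a m /\ Vsub b m) as (m & Hm & Sa & Sb).
  { destruct (kappa_compare a b Ha Hb) as [H|H].
    - exists b. repeat split; auto. intros z; auto.
    - exists a. repeat split; auto; [intros z; auto|]. apply mem_Vsub; assumption. }
  apply (small_inj _ (Vpow (Vpow m))); [|apply small_pow, small_pow, small_mem, Hm].
  set (P := fun z uv => Vmem (fst uv) x /\ Vmem (snd uv) y /\ Veq z (opair (fst uv) (snd uv))).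
  set (c := fun z => epsilon (inhabits (kappa, kappa)) (P z)).
  assert (Hc : forall z, Vmem z (Vprod x y) -> P z (c z)).
  { intros z Hz. apply epsilon_spec. apply Vmem_prod in Hz as (u & v & K). exists (u, v). exact K. }
  exists (fun z => opair (g (fst (c z))) (h (snd (c z)))). split; [|split].
  - intros z z' Hz E. destruct (Hc z Hz) as (H1 & H2 & H3).
    assert (Hz' : Vmem z' (Vprod x y)) by (rewrite <- E; exact Hz).
    destruct (Hc z' Hz') as (H1' & H2' & H3').
    rewrite H3, H3' in E. apply opair_inj in E as [E1 E2].
    apply opair_proper; auto.
  - intros z Hz. destruct (Hc z Hz) as (H1 & H2 & H3).
    apply Vmem_pow. intros w Hw. apply Vmem_pair in Hw. apply Vmem_pow. intros u.
    destruct Hw as [-> | ->]; rewrite Vmem_pair; intros [-> | ->]; auto.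
  - intros z z' Hz Hz' E. destruct (Hc z Hz) as (H1 & H2 & H3).
    destruct (Hc z' Hz') as (H1' & H2' & H3'). apply opair_inj in E as [E1 E2].
    rewrite H3, H3'. apply opair_proper; auto.
Qed.

(** Regularity for arbitrary small sets in place of ordinals: unbounded values would embed [kappa]
    into [y], and hence into an ordinal below [kappa]. *)
Lemma small_bounded y g : small y -> ext_on y g -> (forall a, Vmem a y -> Vmem (g a) kappa) ->
  exists b, Vmem b kappa /\ forall a, Vmem a y -> Vmem (g a) b.
Proof.
  intros (d & Hd & (j & Ej & Hj & Ij)) Eg Hg. apply NNPP. intros N.
  apply (kappa_card d Hd). apply (inj_trans _ y); [|exists j; auto].
  apply (unbounded_inj y g Eg Hg). intros b Hb. apply NNPP. intros L. apply N.
  exists b. split; [exact Hb|]. intros a Ha. apply NNPP. eauto.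
Qed.

End Inaccessible.

(** * Names *)

Section Names.
Context {P : forcing}.
Implicit Types (x y z : name P) (p q r : P).

Lemma forces_eq_mono x y p q : le q p -> forces_eq x y p -> forces_eq x y q.
Proof.
  destruct x as [A f c], y as [B g d]. intros L [H K].
  split; [intros a r Lr La; apply H|intros b r Lr Lb; apply K]; eauto using le_trans.
Qed.

Lemma forces_eq_refl x p : forces_eq x x p.
Proof.
  revert p. induction x as [A f IH c]. intros p. split; intros a q L La;
    exists q, a; auto using le_refl.
Qed.

Lemma forces_eq_sym x y p : forces_eq x y p -> forces_eq y x p.
Proof.
  revert y p. induction x as [A f IH c]. intros [B g d] p [H K]. split.
  - intros b q L Lb. destruct (K b q L Lb) as (r & a & ? & ? & ?). exists r, a. auto.
  - intros a q L La. destruct (H a q L La) as (r & b & ? & ? & ?). exists r, b. auto.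
Qed.

Lemma forces_eq_trans x y z p : forces_eq x y p -> forces_eq y z p -> forces_eq x z p.
Proof.
  revert y z p. induction x as [A f IH c]. intros [B g d] [C h e] p [H K] [H' K']. split.
  - intros a q L La. destruct (H a q L La) as (r & b & L1 & L2 & E).
    destruct (H' b r) as (r' & i & L3 & L4 & E'); [eauto using le_trans..|].
    exists r', i. split; [eauto using le_trans|]. split; [exact L4|].
    apply (IH a (g b)); [eauto using forces_eq_mono|exact E'].
  - intros i q L Li. destruct (K' i q L Li) as (r & b & L1 & L2 & E).
    destruct (K b r) as (r' & a & L3 & L4 & E'); [eauto using le_trans..|].
    exists r', a. split; [eauto using le_trans|]. split; [exact L4|].
    apply (IH a (g b)); [exact E'|eauto using forces_eq_mono].
Qed.

Lemma forces_mono p q (a : form (name P)) : le q p -> forces p a -> forces q a.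
Proof.
  revert p q. induction a as [x y|x y|Q|a IH|a IHa b IHb|f IH]; intros p q L; simpl.
  - destruct y as [B g d]. intros H r Lr. apply H. eauto using le_trans.
  - apply forces_eq_mono, L.
  - auto.
  - intros H r Lr. apply H. eauto using le_trans.
  - intros [H K]. eauto.
  - intros H x. eauto.
Qed.

(** The clauses for atomic formulas already ask only for a dense set of conditions, and a negation
    that failed below [p] would fail below a condition of the dense set. *)
Lemma forces_dense p (a : form (name P)) :
  (forall q, le q p -> exists r, le r q /\ forces r a) -> forces p a.
Proof.
  revert p. induction a as [x y|x y|Q|a IH|a IHa b IHb|f IH]; intros p H; simpl.
  - destruct y as [B g d]. intros q L. destruct (H q L) as (r & Lr & K).
    destruct (K r (le_refl _ _)) as (r' & b & L1 & L2 & E). exists r', b.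
    eauto using le_trans.
  - destruct x as [A f c], y as [B g d]. split.
    + intros a q L La. destruct (H q L) as (r & Lr & [K _]).
      destruct (K a r) as (r' & b & L1 & L2 & E); [apply le_refl|eauto using le_trans|].
      exists r', b. eauto using le_trans.
    + intros b q L La. destruct (H q L) as (r & Lr & [_ K]).
      destruct (K b r) as (r' & a & L1 & L2 & E); [apply le_refl|eauto using le_trans|].
      exists r', a. eauto using le_trans.
  - destruct (H p (le_refl _ _)) as (r & _ & K). exact K.
  - intros q L Hq. destruct (H q L) as (r & Lr & K). apply (K r (le_refl _ _)).
    exact (forces_mono _ _ _ Lr Hq).
  - split; [apply IHa|apply IHb]; intros q L; destruct (H q L) as (r & Lr & K1 & K2); eauto.
  - intros x. apply IH. intros q L. destruct (H q L) as (r & Lr & K). eauto.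
Qed.

Lemma forces_mem_l x y z p : forces_eq x y p -> forces_mem x z p -> forces_mem y z p.
Proof.
  destruct z as [C h e]. intros E H q L. destruct (H q L) as (r & b & L1 & L2 & K).
  exists r, b. repeat split; auto. eapply forces_eq_trans; [|exact K].
  apply forces_eq_sym. eapply forces_eq_mono; [|exact E]. eauto using le_trans.
Qed.

Lemma forces_mem_r x y z p : forces_eq y z p -> forces_mem x y p -> forces_mem x z p.
Proof.
  destruct y as [B g d], z as [C h e]. intros [E _] H q L.
  destruct (H q L) as (r & b & L1 & L2 & K).
  destruct (E b r) as (r' & i & L3 & L4 & K'); [eauto using le_trans|exact L2|].
  exists r', i. split; [eauto using le_trans|]. split; [exact L4|].
  eapply forces_eq_trans; [|exact K']. eauto using forces_eq_mono.
Qed.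

Lemma forces_mem_intro (A : U) (f : A -> name P) (c : A -> P) a p :
  le p (c a) -> forces_mem (f a) (Name A f c) p.
Proof.
  intros L q Lq. exists q, a. repeat split; [apply le_refl|eauto using le_trans|apply forces_eq_refl].
Qed.

Lemma forces_ext x y p :
  (forall q z, le q p -> (forces_mem z x q <-> forces_mem z y q)) -> forces_eq x y p.
Proof.
  destruct x as [A f c], y as [B g d]. intros H. split.
  - intros a q L La. apply (proj1 (H q (f a) L) (forces_mem_intro A f c a q La) q (le_refl _ _)).
  - intros b q L Lb.
    destruct (proj2 (H q (g b) L) (forces_mem_intro B g d b q Lb) q (le_refl _ _))
      as (r & a & L1 & L2 & E).
    exists r, a. auto using forces_eq_sym.
Qed.

End Names.

(* A surjection onto the conditions from an index type small enough to build names. *)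
Record small_forcing (P : forcing) : Type := SmallForcing {
  cidx : U;
  cnd : cidx -> P;
  cnd_surj : forall p, exists i, cnd i = p
}.
Arguments cidx {P} _.
Arguments cnd {P} _ _.

Section NamesModel.
Context {P : forcing} (SP : small_forcing P).

(** Each element of [t] is attached to all conditions below its own that force [phi] of it. The
    conditions are reached through [cnd], since [P] itself need not live among the index types. *)
Definition name_sep (t : name P) (phi : name P -> form (name P)) : name P :=
  match t with Name A f c =>
    Name {ai : A * cidx SP | le (cnd SP (snd ai)) (c (fst ai)) /\
                             forces (cnd SP (snd ai)) (phi (f (fst ai)))}
         (fun ai => f (fst (proj1_sig ai))) (fun ai => cnd SP (snd (proj1_sig ai)))
  end.

Definition names : model (name P).
Proof.
  refine (Model (name P) P (@le P) (@forces P) _ _ _ _ _ _ _ _ _ _ _ _ _ _ _ _).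
  - apply le_refl.
  - apply le_trans.
  - apply forces_mono.
  - apply forces_dense.
  - reflexivity.
  - reflexivity.
  - reflexivity.
  - reflexivity.
  - intros p x. apply forces_eq_refl.
  - intros p x y. apply forces_eq_sym.
  - intros p x y z. apply forces_eq_trans.
  - intros p x y z. apply forces_mem_l.
  - intros p x y z. apply forces_mem_r.
  - intros p x y. apply forces_ext.
  - intros a b. exists (Name bool (fun i : bool => if i then a else b) (fun _ => one)).
    intros p w. split.
    + intros H. apply forces_dense. intros q L.
      destruct (H q L) as (r & i & L1 & _ & E). exists r. split; [exact L1|].
      intros s Ls [N1 N2]. destruct i; [apply (N1 s)|apply (N2 s)];
        (apply le_refl || eauto using forces_eq_mono).
    + intros H q L.
      destruct (classic (exists r, le r q /\ (forces_eq w a r \/ forces_eq w b r)))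
        as [(r & Lr & [E|E])|N].
      * exists r, true. auto using le_one.
      * exists r, false. auto using le_one.
      * exfalso. apply (H q L). split; intros r Lr E; apply N; eauto.
  - intros phi C t. exists (name_sep t phi). destruct t as [A f c]. intros p z. split.
    + intros H. split.
      * intros q L. destruct (H q L) as (r & [[a i] [La Hi]] & L1 & L2 & E).
        exists r, a. simpl in *. eauto using le_trans.
      * apply forces_dense. intros q L. destruct (H q L) as (r & [[a i] [La Hi]] & L1 & L2 & E).
        exists r. split; [exact L1|]. simpl in *. apply (C r (f a)); [apply forces_eq_sym, E|].
        eauto using forces_mono.
    + intros [H K] q L. destruct (H q L) as (r & a & L1 & L2 & E).
      destruct (cnd_surj P SP r) as [i Hi].
      assert (J : le (cnd SP i) (c a) /\ forces (cnd SP i) (phi (f a))).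
      { rewrite Hi. split; [exact L2|]. apply (C r z); [exact E|].
        eapply forces_mono; [|exact K]. eauto using le_trans. }
      exists r, (exist _ (a, i) J). simpl. rewrite Hi. auto using le_refl.
Defined.

End NamesModel.

(** * Check names *)

Section Check.
Context {P : forcing} {SP : small_forcing P}.
Let NM := names SP.
Implicit Types (p q r : world NM).

Lemma check_eq p x y : p ||- check x == check y <-> Veq x y.
Proof.
  revert p y. induction x as [A f IH]; intros p [B g]. split.
  - intros [H K]. split.
    + intros a. destruct (H a p (le_refl _ _) (le_one _ _)) as (r & b & _ & _ & E).
      exists b. exact (proj1 (IH a r (g b)) E).
    + intros b. destruct (K b p (le_refl _ _) (le_one _ _)) as (r & a & _ & _ & E).
      exists a. exact (proj1 (IH a r (g b)) E).
  - intros [H K]. split.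
    + intros a q L _. destruct (H a) as [b E]. exists q, b.
      split; [apply le_refl|]. split; [apply le_one|]. apply (IH a q (g b)), E.
    + intros b q L _. destruct (K b) as [a E]. exists q, a.
      split; [apply le_refl|]. split; [apply le_one|]. apply (IH a q (g b)), E.
Qed.

Lemma mem_check_dense p s y : p ||- s \in check y -> forall q, wle q p ->
  exists r x, wle r q /\ Vmem x y /\ r ||- s == check x.
Proof.
  destruct y as [B g]. intros H q L. destruct (H q L) as (r & b & L1 & _ & E).
  exists r, (g b). split; [exact L1|]. split; [exists b; reflexivity|exact E].
Qed.

Lemma mem_check_elim p s y c : p ||- s \in check y ->
  (forall q x, wle q p -> Vmem x y -> q ||- s == check x -> q ||- c) -> p ||- c.
Proof.
  intros H K. apply frc_dense. intros q L.
  destruct (mem_check_dense _ _ _ H q L) as (r & x & Lr & Hx & E).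
  exists r. split; [exact Lr|]. apply (K r x); auto. eapply wle_trans; eassumption.
Qed.

Lemma check_mem p x y : p ||- check x \in check y <-> Vmem x y.
Proof.
  split.
  - intros H. destruct (mem_check_dense _ _ _ H p (wle_refl _ _ _)) as (r & z & _ & Hz & E).
    apply check_eq in E. rewrite E. exact Hz.
  - intros H. destruct y as [B g]. destruct H as [b E].
    apply (frc_mem_l _ _ _ (check (g b))); [apply check_eq; symmetry; exact E|].
    intros q L. exists q, b. split; [apply le_refl|].
    split; [apply le_one|apply forces_eq_refl].
Qed.

Lemma check_subset p x y : p ||- subset (check x) (check y) <-> Vsub x y.
Proof.
  rewrite frc_subset. split.
  - intros H z Hz. apply (check_mem p). apply H; [apply wle_refl|]. apply check_mem, Hz.
  - intros H q z L Hz. apply (mem_check_elim _ _ _ _ Hz). intros r w Lr Hw E.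
    frw E. apply check_mem, H, Hw.
Qed.

Lemma check_ordinal p x : Ord x -> p ||- ordinal (check x).
Proof.
  intros [T L]. apply frc_ordinal. split.
  - intros q y z _ Hy Hz. apply (mem_check_elim _ _ _ _ Hy). intros r w Lr Hw E.
    down Lr. frwin E Hz. apply (mem_check_elim _ _ _ _ Hz). intros r' w' Lr' Hw' E'.
    frw E'. apply check_mem. eapply T; eassumption.
  - intros q y z _ Hy Hz. apply (mem_check_elim _ _ _ _ Hy). intros r w Lr Hw E.
    down Lr. apply (mem_check_elim _ _ _ _ Hz). intros r' w' Lr' Hw' E'.
    down Lr'. frw E. frw E'. destruct (L w w' Hw Hw') as [H|[H|H]].
    + apply frc_or_l, check_mem, H.
    + apply frc_or_r, frc_or_l, check_eq, H.
    + apply frc_or_r, frc_or_r, check_mem, H.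
Qed.

End Check.

(** * Coding of the conditions, and Zorn's lemma *)

(** [Vcarrier x] enumerates the conditions through the inverse of [e], and [o] ranks them by
    ordinals below [kappa] via the injection of [x] into [kappa]. The ranks are the well-order used
    for mixing. *)
Lemma size_lt_rank (P : forcing) (kappa : V) : size_lt P kappa ->
  exists (x : V) (e : P -> V) (SP : small_forcing P) (o : P -> V),
    (forall p, Vmem (e p) x) /\ (forall y, Vmem y x -> exists p, Veq y (e p)) /\
    (forall p q, Veq (e p) (e q) -> p = q) /\ sat (card_lt x kappa) /\
    (forall p, Vmem (o p) kappa) /\ (forall p q, Veq (o p) (o q) -> p = q).
Proof.
  intros (x & e & He & Hs & Hi & C). destruct (C) as [J _].
  apply sat_injects in J as (g & Eg & Hg & Ig).
  assert (S : forall p, exists i, epsilon (inhabits one) (fun p => Veq (Vfam x i) (e p)) = p).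
  { intros p. pose proof (He p) as K. apply Vmem_fam in K as [i Hp]. exists i.
    apply Hi. rewrite Hp. symmetry.
    apply (epsilon_spec (inhabits one) (fun p => Veq (Vfam x i) (e p))).
    apply Hs, Vfam_mem. }
  exists x, e, (SmallForcing P (Vcarrier x) _ S), (fun p => g (e p)).
  repeat split; auto; apply C.
Qed.

(** The empty chain counts as a chain, so the hypothesis also yields that the empty predicate
    satisfies [Q]. *)
Lemma zorn_union (I : Type) (Q : (I -> Prop) -> Prop) :
  (forall F : (I -> Prop) -> Prop, (forall X, F X -> Q X) ->
     (forall X Y, F X -> F Y -> (forall i, X i -> Y i) \/ (forall i, Y i -> X i)) ->
     Q (fun i => exists2 X, F X & X i)) ->
  exists X, Q X /\ forall Y, (forall i, X i -> Y i) -> Q Y -> forall i, Y i -> X i.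
Proof.
  intros H. destruct (classical_sets.Zorn_bigcup (P := Q)) as [X [HX HM]].
  - intros F FQ FT. apply H; [exact FQ|exact FT].
  - exists X. split; [exact HX|]. intros Y XY QY. apply NNPP. intros N.
    apply (HM Y); [split; [exact XY|exact N]|exact QY].
Qed.

(** * Elements of an arbitrary name *)

Section NameParts.
Context {P : forcing}.
Definition ndom (x : name P) : U := match x with Name A _ _ => A end.
Definition nfam (x : name P) : ndom x -> name P := match x with Name _ f _ => f end.
Definition ncnd (x : name P) : ndom x -> P := match x with Name _ _ c => c end.

Lemma forces_mem_iff (z x : name P) p : forces_mem z x p <->
  forall q, le q p -> exists r b, le r q /\ le r (ncnd x b) /\ forces_eq z (nfam x b) r.
Proof. destruct x; reflexivity. Qed.

Context {SP : small_forcing P}.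
Let NM := names SP.
Implicit Types (p q r : world NM).

Lemma mem_name_elim p x z c : p ||- z \in x ->
  (forall q b, wle q p -> wle q (ncnd x b : world NM) -> q ||- z == nfam x b -> q ||- c) -> p ||- c.
Proof.
  intros H K. apply frc_dense. intros q L.
  destruct (proj1 (forces_mem_iff z x p) H q L) as (r & b & L1 & L2 & E).
  exists r. split; [exact L1|]. apply (K r b); [|exact L2|exact E].
  eauto using wle_trans.
Qed.

Lemma mem_name_intro p x b : wle p (ncnd x b : world NM) -> p ||- nfam x b \in x.
Proof.
  intros L. apply forces_mem_iff. intros q Lq. exists q, b. split; [apply le_refl|].
  split; [eapply le_trans; eassumption|apply forces_eq_refl].
Qed.
End NameParts.

(** * Fullness *)

Section Fullness.
Context {P : forcing} {SP : small_forcing P}.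
Variables (kappa : V) (o : P -> V).
Hypothesis kappa_ord : Ord kappa.
Hypothesis o_mem : forall p, Vmem (o p) kappa.
Hypothesis o_inj : forall p q, Veq (o p) (o q) -> p = q.
Let NM := names SP.
Variable phi : name P -> form (name P).
Hypothesis phi_congr : congruent (M := NM) phi.
Implicit Types (p q r : world NM).

Let good p : Prop := exists x, p ||- phi x.
Let wit p : name P := epsilon (inhabits (check kappa)) (fun x => p ||- phi x).

(* [q] lies below [p] and is incompatible with all good conditions of smaller rank:
   for distinct [p] these sets are incompatible, and their union is dense. *)
Let owned p q : Prop := wle q p /\ good p /\
  forall p', good p' -> Vmem (o p') (o p) -> forall r, wle r q -> ~ wle r p'.

(** The mixture of the names [wit p]: an element of [wit p] enters only under conditions owned by
    [p], so the mixture agrees with [wit p] below each of these. *)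
Let mixed : name P :=
  Name {i : cidx SP & {b : ndom (wit (cnd SP i)) & {j : cidx SP |
          wle (m := NM) (cnd SP j) (ncnd (wit (cnd SP i)) b) /\ owned (cnd SP i) (cnd SP j)}}}
       (fun c => nfam (wit (cnd SP (projT1 c))) (projT1 (projT2 c)))
       (fun c => cnd SP (proj1_sig (projT2 (projT2 c)))).

(** If the ranks differed, the condition of smaller rank would be good and lie above the common
    extension [r], which ownership by the other one forbids. *)
Lemma owned_unique p p' q q' r :
  owned p q -> owned p' q' -> wle r q -> wle r q' -> p = p'.
Proof.
  intros (L & G & N) (L' & G' & N') K K'.
  destruct (proj2 kappa_ord (o p) (o p') (o_mem p) (o_mem p')) as [H|[H|H]].
  - exfalso. apply (N' p G H r K'). eauto using wle_trans.
  - apply o_inj, H.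
  - exfalso. apply (N p' G' H r K). eauto using wle_trans.
Qed.

Lemma mixed_owned p q : owned p q -> q ||- mixed == wit p.
Proof.
  intros O. apply frc_ext. intros r z L. split; intros H.
  - apply (mem_name_elim _ _ _ _ H). intros r' [i [b [j [L1 O']]]] Lr Lj E. simpl in Lj, E.
    assert (Ep : cnd SP i = p).
    { eapply owned_unique; [exact O'|exact O|exact Lj|eauto using wle_trans]. }
    apply (frc_mem_l _ _ _ _ _ _ (frc_eq_sym _ _ _ _ _ E)). subst p.
    apply mem_name_intro. eauto using wle_trans.
  - apply (mem_name_elim _ _ _ _ H). intros r' b Lr Lb E.
    apply (frc_mem_l _ _ _ _ _ _ (frc_eq_sym _ _ _ _ _ E)).
    destruct (cnd_surj P SP p) as [i Hi]. destruct (cnd_surj P SP r') as [j Hj]. subst p.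
    assert (J : wle (m := NM) (cnd SP j) (ncnd (wit (cnd SP i)) b) /\ owned (cnd SP i) (cnd SP j)).
    { rewrite Hj. split; [exact Lb|]. destruct O as (O1 & O2 & O3).
      assert (Lq : wle r' q) by (eauto using wle_trans).
      split; [eauto using wle_trans|]. split; [exact O2|].
      intros p' Gp' Ho s Ls. apply (O3 p' Gp' Ho). eauto using wle_trans. }
    apply (mem_name_intro r' mixed (existT _ i (existT _ b (exist _ j J)))).
    simpl. rewrite Hj. apply wle_refl.
Qed.

Lemma fullness : (one : world NM) ||- Ex phi -> exists x, (one : world NM) ||- phi x.
Proof.
  intros H. exists mixed. apply frc_dense. intros q L.
  (* Among the good conditions compatible with [q], take [p] of least rank. Nothing below a common
     extension [r] of [p] and [q] lies below a good condition of smaller rank, so [p] owns [r]. *)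
  destruct (Vmem_minimal (fun v => exists p, Veq v (o p) /\ good p /\ exists r, wle r p /\ wle r q))
    as (v & (p & Ev & G & r & Lp & Lq) & Hmin).
  { destruct (frc_ex_dense _ _ H q L) as (r & x & Lr & Hx).
    exists (o r), r. split; [reflexivity|]. split; [exists x; exact Hx|].
    exists r. split; [apply wle_refl|exact Lr]. }
  exists r. split; [exact Lq|].
  assert (O : owned p r).
  { split; [exact Lp|]. split; [exact G|]. intros p' G' Ho s Ls Ls'.
    apply (Hmin (o p')); [rewrite Ev; exact Ho|]. exists p'. split; [reflexivity|].
    split; [exact G'|]. exists s. split; [exact Ls'|]. eauto using wle_trans. }
  apply (phi_congr r (wit p)); [apply frc_eq_sym, mixed_owned, O|].
  eapply frc_mono; [exact Lp|].
  apply (epsilon_spec (inhabits (check kappa)) (fun x => p ||- phi x)). exact G.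
Qed.

End Fullness.

(** * Maximal branches of a name for a tree *)

Section Branches.
Context {P : forcing} {SP : small_forcing P}.
Let NM := names SP.
Implicit Types (p q r : world NM) (s t u c : name P).
Variables (kappa : V) (T : name P).
Hypothesis kappa_ord : Ord kappa.

(** The length of a node is forced to be an ordinal below [kappa] but is decided only densely; a
    forced goal may be proved at the deciding conditions. *)
Lemma tree_node p t (c : form (name P)) : p ||- is_tree T (check kappa) -> p ||- t \in T ->
  (forall q a, wle q p -> Vmem a kappa -> q ||- fun_on t (check a) -> q ||- c) -> p ||- c.
Proof.
  intros HT Ht K. unfold is_tree in HT. fand HT as [H _]. fspec H t.
  apply (frc_mp _ _ _ H) in Ht. clear H. fex Ht as a Ht. fand Ht as [Ha Ht].
  unfold fun_from_to in Ht. fand Ht as [Ht _].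
  apply (mem_check_elim _ _ _ _ Ha). intros r x Lr Hx E. down Lr. frwin E Ht.
  apply (K r x); assumption.
Qed.

Lemma tree_closed p s t b : p ||- is_tree T (check kappa) -> p ||- t \in T -> Ord b ->
  p ||- fun_on s (check b) -> p ||- subset s t -> p ||- s \in T.
Proof.
  intros HT Ht Ob Fs S. apply (tree_node _ _ _ HT Ht). intros q a L Ha Ft. down L.
  unfold is_tree in HT. fand HT as [_ H]. fspec H t. apply (frc_mp _ _ _ H) in Ht. clear H.
  fspec Ht s. apply (frc_mp _ _ _ Ht). eapply subset_init_seg; [exact Fs| |exact Ft|exact S].
  apply check_ordinal, Ob.
Qed.

Lemma init_seg_refl p t : p ||- is_tree T (check kappa) -> p ||- t \in T -> p ||- init_seg t t.
Proof.
  intros HT Ht. apply (tree_node _ _ _ HT Ht). intros q a L Ha Ft.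
  eapply subset_init_seg; [exact Ft| |exact Ft|apply subset_refl].
  apply check_ordinal. eapply Ord_mem; eassumption.
Qed.

Definition comparable s t : form (name P) := (init_seg s t \/ init_seg t s)%form.
Definition all_comparable x y : form (name P) :=
  (\all s \in x, \all t \in y, comparable s t)%form.

Lemma frc_all_comparable p x y : p ||- all_comparable x y <->
  forall q s t, wle q p -> q ||- s \in x -> q ||- t \in y -> q ||- comparable s t.
Proof.
  unfold all_comparable. split.
  - intros H q s t L Hs Ht. down L. fspec H s. apply (frc_mp _ _ _ H) in Hs. clear H.
    fspec Hs t. apply (frc_mp _ _ _ Hs Ht).
  - intros H. fall s. apply frc_imp. intros q L Hs. fall t. apply frc_imp. intros r Lr Ht.
    down Lr. auto.
Qed.

Lemma comparable_sym p s t : p ||- comparable s t -> p ||- comparable t s.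
Proof.
  unfold comparable. intros H. for H as H; [apply frc_or_r|apply frc_or_l]; exact H.
Qed.

Let idx : Type := (ndom T * cidx SP)%type.

(** Coding names for subsets of [T] by predicates on the fixed type [idx] makes Zorn's lemma for
    predicates applicable, with inclusion as the order. *)
Definition subname (X : idx -> Prop) : name P :=
  Name {ai : idx | X ai /\ wle (m := NM) (cnd SP (snd ai)) (ncnd T (fst ai))}
       (fun ai => nfam T (fst (proj1_sig ai))) (fun ai => cnd SP (snd (proj1_sig ai))).

Lemma mem_subname_elim p X z (c : form (name P)) : p ||- z \in subname X ->
  (forall q a i, wle q p -> X (a, i) -> wle q (cnd SP i : world NM) ->
     wle (m := NM) (cnd SP i) (ncnd T a) -> q ||- z == nfam T a -> q ||- c) -> p ||- c.
Proof.
  intros H K. apply (mem_name_elim _ _ _ _ H). intros q [[a i] [HX L1]] L L2 E. simpl in L1, L2, E.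
  apply (K q a i); assumption.
Qed.

Lemma mem_subname_intro p (X : idx -> Prop) a i : X (a, i) -> wle p (cnd SP i : world NM) ->
  wle (m := NM) (cnd SP i) (ncnd T a) -> p ||- nfam T a \in subname X.
Proof.
  intros HX L1 L2. apply (mem_name_intro p (subname X) (exist _ (a, i) (conj HX L2))). exact L1.
Qed.

Lemma subname_subset p X : p ||- subset (subname X) T.
Proof.
  apply frc_subset. intros q z L Hz. apply (mem_subname_elim _ _ _ _ Hz).
  intros r a i Lr _ L1 L2 E. frw E. apply mem_name_intro. eauto using wle_trans.
Qed.

(** The given [c] need not have the form [subname X]. Zorn's lemma is therefore applied to chains
    comparable with [c], and [c] is absorbed at the end by maximality. *)
Lemma max_branch_exists p c : p ||- is_tree T (check kappa) -> p ||- is_chain c T ->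
  exists b, p ||- is_max_branch b T /\ p ||- subset c b.
Proof.
  intros HT HC. unfold is_chain in HC. fand HC as [Sc Cc].
  change (p ||- all_comparable c c) in Cc.
  set (Q := fun X => p ||- all_comparable (subname X) (subname X) /\
                     p ||- all_comparable (subname X) c).
  destruct (zorn_union _ Q) as (X & [X1 X2] & Xmax).
  { intros F FQ FT. split; apply frc_all_comparable; intros q s t L Hs Ht.
    - apply (mem_subname_elim _ _ _ _ Hs). intros r a i Lr [X HX Hai] L1 L2 E. down Lr.
      apply (mem_subname_elim _ _ _ _ Ht). intros r' a' i' Lr' [Y HY Hai'] L1' L2' E'.
      assert (exists Z, F Z /\ Z (a, i) /\ Z (a', i')) as (Z & HZ & Z1 & Z2).
      { destruct (FT X Y HX HY); [exists Y|exists X]; auto. }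
      down Lr'. apply FQ in HZ as [HZ _]. rewrite frc_all_comparable in HZ.
      apply HZ; [assumption|..].
      + frw E. apply (mem_subname_intro _ _ a i); assumption.
      + frw E'. apply (mem_subname_intro _ _ a' i'); assumption.
    - apply (mem_subname_elim _ _ _ _ Hs). intros r a i Lr [X HX Hai] L1 L2 E. down Lr.
      apply FQ in HX as [_ HX]. rewrite frc_all_comparable in HX. apply HX; [assumption| |exact Ht].
      frw E. apply (mem_subname_intro _ _ a i); assumption. }
  (* Maximality can be tested below any [r]: an index of [T] paired with a condition below [r] may
     be added to [X], and this adds an element to the name only below that condition. *)
  assert (Hmax : forall r s, wle r p -> r ||- s \in T ->
    (forall q t, wle q r -> q ||- t \in subname X -> q ||- comparable s t) ->
    (forall q t, wle q r -> q ||- t \in c -> q ||- comparable s t) -> r ||- s \in subname X).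
  { intros r s L Hs Cb Cs. pose proof Hs as K. apply (mem_name_elim _ _ _ _ K). clear K.
    intros r' a Lr La E. down Lr. destruct (cnd_surj P SP r') as [i Hi].
    frw E. apply (mem_subname_intro _ _ a i);
      [|rewrite Hi; apply wle_refl|rewrite Hi; exact La].
    set (Y := fun ai => X ai \/ ai = (a, i)).
    apply (Xmax Y); unfold Y; [auto| |auto]. fold Y.
    assert (Split : forall q z d, q ||- z \in subname Y ->
      (forall q', wle q' q -> q' ||- z \in subname X -> q' ||- d) ->
      (forall q', wle q' q -> wle q' r' -> q' ||- z == s -> q' ||- d) -> q ||- d).
    { intros q z d H K1 K2. apply (mem_subname_elim _ _ _ _ H).
      intros q' a' i' Lq [HX|HX] L1 L2 E'.
      - apply (K1 q' Lq). frw E'. apply (mem_subname_intro _ _ a' i'); assumption.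
      - injection HX as -> ->. rewrite Hi in L1. apply (K2 q' Lq L1).
        eapply frc_eq_trans; [exact E'|]. apply frc_eq_sym. eapply frc_mono; eassumption. }
    rewrite frc_all_comparable in X1, X2, Cc.
    split; apply frc_all_comparable; intros q u v Lq Hu Hv.
    - apply (Split _ _ _ Hu); intros q' Lq'; down Lq'.
      + intros Hu'. apply (Split _ _ _ Hv); intros q2 Lq2; down Lq2.
        * intros Hv'. apply X1; assumption.
        * intros Lr2 Ev. frw Ev. apply comparable_sym, Cb; [eauto using wle_trans|exact Hu'].
      + intros Lr' Eu. apply (Split _ _ _ Hv); intros q2 Lq2; down Lq2.
        * intros Hv'. frw Eu. apply Cb; [eauto using wle_trans|exact Hv'].
        * intros Lr2 Ev. frw Eu. frw Ev. apply frc_or_l.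
          apply init_seg_refl; [eapply frc_mono; [|exact HT]; assumption|].
          eapply frc_mono; [|exact Hs]. exact Lr2.
    - apply (Split _ _ _ Hu); intros q' Lq'; down Lq'.
      + intros Hu'. apply X2; assumption.
      + intros Lr' Eu. frw Eu. apply Cs; [eauto using wle_trans|exact Hv]. }
  rewrite frc_all_comparable in X1, X2, Cc.
  assert (Scb : p ||- subset c (subname X)).
  { apply frc_subset. intros r s L Hs. apply Hmax; [exact L| | |].
    - eapply subset_mem; [|exact Hs]. eapply frc_mono; eassumption.
    - intros q t Lq Ht. down Lq. apply comparable_sym, X2; eauto using wle_trans.
    - intros q t Lq Ht. down Lq. apply Cc; eauto using wle_trans. }
  exists (subname X). split; [|exact Scb].
  unfold is_max_branch. fsplit.
  - unfold is_chain. fsplit; [apply subname_subset|].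
    apply frc_all_comparable. exact X1.
  - fall d. fimp H. fand H as [Hd Sd]. unfold is_chain in Hd. fand Hd as [Sd' Cd].
    apply subset_antisym; [|exact Sd]. apply frc_subset. intros r s Lr Hs. down Lr.
    change (r ||- all_comparable d d) in Cd. rewrite frc_all_comparable in Cd.
    apply Hmax; [assumption|eapply subset_mem; eassumption|..].
    + intros q' t Lq Ht. down Lq. apply Cd; [exact Lq|exact Hs|].
      eapply subset_mem; eassumption.
    + intros q' t Lq Ht. down Lq. apply Cd; [exact Lq|exact Hs|].
      eapply subset_mem; [exact Sd|]. eapply subset_mem; eassumption.
Qed.

End Branches.

(** * The derived tree *)

Section Derived.
Variables (kappa : V) (P : forcing) (T : name P).
Hypothesis h_kappa : sat (inaccessible kappa).
Variable SP : small_forcing P.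
Variables (xP : V) (e : P -> V) (o : P -> V).
Hypothesis e_mem : forall p, Vmem (e p) xP.
Hypothesis e_surj : forall y, Vmem y xP -> exists p, Veq y (e p).
Hypothesis e_inj : forall p q, Veq (e p) (e q) -> p = q.
Hypothesis xP_small : sat (card_lt xP kappa).
Hypothesis o_mem : forall p, Vmem (o p) kappa.
Hypothesis o_inj : forall p q, Veq (o p) (o q) -> p = q.
Local Notation NM := (names SP).
Let top : world NM := one.
Hypothesis h_T : top ||- regular_tree T (check kappa).
Implicit Types (p q r : world NM) (t u : name P) (a b : V).

Let kord : Ord kappa := kappa_ord kappa h_kappa.

(** * Nodes of the forced tree and their names *)

Lemma frc_top p (c : form (name P)) : top ||- c -> p ||- c.
Proof. apply frc_mono. apply (le_one P p). Qed.

Lemma frc_fullness phi : congruent (M := NM) phi -> top ||- Ex phi -> exists x, top ||- phi x.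
Proof. apply (fullness kappa o kord o_mem o_inj). Qed.

Lemma T_tree p : p ||- is_tree T (check kappa).
Proof. apply frc_top. unfold regular_tree in h_T. rewrite frc_and in h_T. tauto. Qed.

Definition node p t a : Prop := p ||- t \in T /\ p ||- fun_on t (check a).

Lemma node_mono p q t a : wle q p -> node p t a -> node q t a.
Proof. intros L [H K]. split; eapply frc_mono; eassumption. Qed.

Lemma check_Ord p a : Vmem a kappa -> p ||- ordinal (check a).
Proof. intros H. apply check_ordinal. eapply Ord_mem; eassumption. Qed.

Lemma node_init_seg p s t b a : Vmem b kappa ->
  node p s b -> node p t a -> (p ||- init_seg s t <-> p ||- subset s t).
Proof.
  intros Hb [_ Fs] [_ Ft]. split; [apply init_seg_subset|].
  intros S. eapply subset_init_seg; [exact Fs|apply check_Ord, Hb|exact Ft|exact S].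
Qed.

Lemma node_subset_len p s t b a : node p s b -> node p t a -> p ||- subset s t -> Vsub b a.
Proof.
  intros [_ Fs] [_ Ft] S. apply (check_subset p). eapply fun_subset_dom; eassumption.
Qed.

Lemma node_subset_eq p s t b a : node p s b -> node p t a -> Vsub a b ->
  p ||- subset s t -> p ||- s == t.
Proof.
  intros Ns Nt H S. pose proof (node_subset_len _ _ _ _ _ Ns Nt S) as K.
  assert (E : p ||- check b == check a) by (apply check_eq, Vsub_antisym; assumption).
  destruct Ns as [_ Fs], Nt as [_ Ft]. frwin E Fs.
  eapply fun_subset_eq; eassumption.
Qed.

(** If it is [t] that is an initial segment of [s], the bound on the lengths makes the two nodes
    equal. *)
Lemma comparable_subset p s t b a : node p s b -> node p t a -> Vsub b a ->
  p ||- comparable s t -> p ||- subset s t.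
Proof.
  intros Ns Nt H C. unfold comparable in C. for C as C.
  - apply init_seg_subset, C.
  - apply init_seg_subset in C.
    apply eq_subset, frc_eq_sym. apply (node_subset_eq _ _ _ a b);
      [eapply node_mono; eassumption|eapply node_mono; eassumption|exact H|exact C].
Qed.

Lemma level_reach p c a : p ||- is_chain c T -> Vmem a kappa ->
  p ||- \ex y, (y \in T /\ fun_on y (check a) /\ \all s \in c, comparable s y).
Proof.
  intros HC Ha.
  destruct (max_branch_exists kappa T kord p c (T_tree p) HC) as (b & Hb & Sb).
  pose proof (frc_top p _ h_T) as HT. unfold regular_tree in HT.
  fand HT as [_ [_ [_ [HB _]]]]. fspec HB b. pose proof (frc_mp _ _ _ HB Hb) as HL. clear HB.
  unfold has_length in HL. fand HL as [_ HL]. fspec HL (check (P := P) a).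
  rewrite frc_iff in HL. pose proof (proj1 (HL p (wle_refl _ _ _))) as K.
  assert (Hc : p ||- check a \in check kappa) by (apply check_mem, Ha).
  specialize (K Hc). clear HL Hc. fex K as y K. fand K as [Hy Fy].
  unfold is_max_branch, is_chain in Hb. fand Hb as [[HbT Hb] _].
  fwit y. fsplit; [eapply subset_mem; eassumption|]. fsplit; [exact Fy|].
  fall s. fimp Hs. change (q0 ||- all_comparable b b) in Hb. rewrite frc_all_comparable in Hb.
  apply Hb; [apply wle_refl|eapply subset_mem; eassumption|exact Hy].
Qed.

Lemma node_extend p t b a : node p t b -> Vmem a kappa -> Vsub b a ->
  p ||- \ex y, (y \in T /\ fun_on y (check a) /\ subset t y).
Proof.
  intros [Ht Ft] Ha S. destruct (upair_exists (M := NM) t t) as [c Hc].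
  assert (K : p ||- is_chain c T).
  { unfold is_chain. fsplit.
    - apply frc_subset. intros q z L Hz. down L.
      pose proof (singleton_elim _ _ _ _ (Hc q) Hz) as E. frw E. exact Ht.
    - apply frc_all_comparable. intros q s s' L Hs Hs'. down L.
      pose proof (singleton_elim _ _ _ _ (Hc q) Hs) as E.
      pose proof (singleton_elim _ _ _ _ (Hc q) Hs') as E'.
      frw E. frw E'. apply frc_or_l. apply (init_seg_refl kappa T kord); [apply T_tree|exact Ht]. }
  pose proof (level_reach p c a K Ha) as H. fex H as y H. fand H as [Hy [Fy H]].
  fwit y. fsplit; [exact Hy|]. fsplit; [exact Fy|]. fspec H t.
  apply (comparable_subset _ _ _ b a); [split; assumption|split; assumption|exact S|].
  apply (frc_mp _ _ _ H). eapply upair_l. apply Hc.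
Qed.

(** A ground-model chain of nodes, read as a name [c] with all conditions equal to [one], is forced
    to be a chain of [T]. Some node on level [a] is forced to be comparable with all of it, and
    fullness names one. *)
Lemma family_extend (I : U) (tau : I -> name P) (len : I -> V) a : Vmem a kappa ->
  (forall i, node top (tau i) (len i) /\ Vmem (len i) kappa /\ Vsub (len i) a) ->
  (forall i j, top ||- subset (tau i) (tau j) \/ top ||- subset (tau j) (tau i)) ->
  exists y, node top y a /\ forall i, top ||- subset (tau i) y.
Proof.
  intros Ha HN HC. set (c := Name I tau (fun _ => one)).
  assert (K : top ||- is_chain c T).
  { unfold is_chain. fsplit.
    - apply frc_subset. intros q z L Hz. apply (mem_name_elim _ _ _ _ Hz). intros r i _ _ E.
      frw E. apply frc_top. apply HN.
    - apply frc_all_comparable. intros q s t L Hs Ht.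
      apply (mem_name_elim _ _ _ _ Hs). intros r i Lr _ E. down Lr.
      apply (mem_name_elim _ _ _ _ Ht). intros r' j Lr' _ E'. down Lr'. frw E. frw E'.
      destruct (HN i) as (Ni & Ki & _). destruct (HN j) as (Nj & Kj & _).
      destruct (HC i j) as [H|H]; [apply frc_or_l|apply frc_or_r]; apply frc_top.
      + exact (proj2 (node_init_seg _ _ _ _ _ Ki Ni Nj) H).
      + exact (proj2 (node_init_seg _ _ _ _ _ Kj Nj Ni) H). }
  pose proof (level_reach top c a K Ha) as H.
  apply frc_fullness in H; [|unfold comparable; congr_tac].
  destruct H as [y H]. fand H as [Hy [Fy H]]. exists y. split; [split; assumption|].
  intros i. destruct (HN i) as (Ni & Ki & Si).
  apply (comparable_subset _ _ _ (len i) a); [exact Ni|split; assumption|exact Si|].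
  fspec H (tau i). apply (frc_mp _ _ _ H). apply (mem_name_intro top c i). apply wle_refl.
Qed.

(** * Coding one level of the derived tree below [kappa] *)

Section LevelCode.
Variable a : V.
Variables L fh : name P.
Hypothesis HL : forall p t, p ||- t \in L <-> node p t a.
Hypothesis fh_fun : top ||- fun_from_to fh L (check kappa).
Hypothesis fh_inj : forall p s t z, p ||- maps fh s z -> p ||- maps fh t z -> p ||- s == t.
Hypothesis not_injects : forall p, ~ p ||- injects (check kappa) L.

Lemma fh_value p t : node p t a -> forall q, wle q p ->
  exists r c, wle r q /\ Vmem c kappa /\ r ||- maps fh t (check c).
Proof.
  intros N q Lq. apply (node_mono _ _ _ _ Lq) in N. apply HL in N.
  pose proof (frc_top q _ fh_fun) as F. unfold fun_from_to in F. fand F as [F1 F2].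
  pose proof (fun_on_total _ _ _ _ F1 N) as K.
  destruct (frc_ex_dense _ _ K q (wle_refl _ _ _)) as (r & z & Lr & Hz). down Lr.
  fspec F2 t. fspec F2 z. pose proof (frc_mp _ _ _ F2 Hz) as Kz.
  destruct (mem_check_dense _ _ _ Kz r (wle_refl _ _ _)) as (r' & c & Lr' & Hc & E).
  exists r', c. split; [eauto using wle_trans|]. split; [exact Hc|].
  down Lr'. frwin E Hz. exact Hz.
Qed.

Lemma fh_check_fun p t b c : p ||- maps fh t (check b) -> p ||- maps fh t (check c) -> Veq b c.
Proof.
  intros Hb Hc. pose proof (frc_top p _ fh_fun) as F. unfold fun_from_to in F. fand F as [F _].
  apply (check_eq p). eapply fun_on_fun; eassumption.
Qed.

Lemma pair_name : exists pr : name P -> name P -> name P,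
  forall x y p, p ||- is_pair (pr x y) x y.
Proof.
  exists (fun x y => epsilon (inhabits x) (fun z => forall p, p ||- is_pair z x y)).
  intros x y. apply (epsilon_spec (inhabits x) (fun z => forall p, p ||- is_pair z x y)).
  apply pair_exists.
Qed.

(* Otherwise [kappa] many nodes would get distinct values decided by the single condition [p],
   and [p] would force [kappa] to inject into the level. *)
Lemma fh_values_bounded p : exists b, Vmem b kappa /\
  forall t c, node top t a -> Vmem c kappa -> p ||- maps fh t (check c) -> Vmem c b.
Proof.
  apply NNPP. intros N.
  assert (Cg : Vcongr (fun c => exists t, node top t a /\ p ||- maps fh t (check c))).
  { intros c c' E (t & Ht & K). exists t. split; [exact Ht|].
    assert (E' : p ||- check c == check c') by (apply check_eq, E). frwin E' K. exact K. }
  set (y := Vsep kappa (fun c => exists t, node top t a /\ p ||- maps fh t (check c))).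
  assert (J : inj kappa y).
  { apply (unbounded_inj kappa h_kappa y (fun c => c)).
    - intros c c' _ E. exact E.
    - intros c Hc. apply Vmem_sep in Hc; [|exact Cg]. tauto.
    - intros b Hb. apply NNPP. intros K. apply N. exists b. split; [exact Hb|].
      intros t c Nt Hc Hm. apply NNPP. intros Nc. apply K. exists c. split; [|exact Nc].
      apply Vmem_sep; [exact Cg|]. eauto. }
  destruct J as (h & Eh & Hh & Ih).
  set (tau := fun xi => epsilon (inhabits T)
     (fun t => node top t a /\ p ||- maps fh t (check (h xi)))).
  assert (Htau : forall xi, Vmem xi kappa ->
    node top (tau xi) a /\ p ||- maps fh (tau xi) (check (h xi))).
  { intros xi Hxi. apply (epsilon_spec (inhabits T)
     (fun t => node top t a /\ p ||- maps fh t (check (h xi)))).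
    pose proof (Hh xi Hxi) as K. apply Vmem_sep in K; [|exact Cg]. apply K. }
  destruct pair_name as [pr Hpr].
  (* The pairs carry the condition [one], but it is [p] that decides the values [h xi] of [fh], and
     so [p] that forces [g] to be an injection. *)
  set (g := Name (Vcarrier kappa)
     (fun i => pr (check (Vfam kappa i)) (tau (Vfam kappa i))) (fun _ => one)).
  assert (Hg : forall q z (c : form (name P)), q ||- z \in g ->
    (forall r i, wle r q -> r ||- is_pair z (check (Vfam kappa i)) (tau (Vfam kappa i)) ->
       r ||- c) -> q ||- c).
  { intros q z c Hz K. apply (mem_name_elim _ _ _ _ Hz). intros r i Lr _ E.
    apply (K r i Lr). frw E. apply Hpr. }
  assert (Hm : forall q x z (c : form (name P)), q ||- maps g x z ->
    (forall r i, wle r q -> r ||- x == check (Vfam kappa i) ->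
       r ||- z == tau (Vfam kappa i) -> r ||- c) -> q ||- c).
  { intros q x z c H K. unfold maps in H. fex H as w H. fand H as [Hw Hp].
    apply (Hg _ _ _ Hw). intros r i Lr Hp'. down Lr. apply (K r i); [assumption| |].
    - eapply pair_inj_l; eassumption.
    - eapply pair_inj_r; eassumption. }
  apply (not_injects p). unfold injects. fwit g. fsplit; [unfold fun_from_to; fsplit|].
  - apply fun_on_intro.
    + intros q z Lq Hz. apply (Hg _ _ _ Hz). intros r i Lr Hp.
      fwit (check (P := P) (Vfam kappa i)). fsplit; [apply check_mem, Vfam_mem|].
      fwit (tau (Vfam kappa i)). exact Hp.
    + intros q x Lq Hx. apply (mem_check_elim _ _ _ _ Hx). intros r xi Lr Hxi E.
      apply Vmem_fam in Hxi as [i Hi]. fwit (tau (Vfam kappa i)).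
      assert (E' : r ||- x == check (Vfam kappa i)).
      { eapply frc_eq_trans; [exact E|]. apply check_eq, Hi. }
      frw E'. apply (maps_intro _ _ (pr (check (Vfam kappa i)) (tau (Vfam kappa i))));
        [|apply Hpr]. apply (mem_name_intro r g i). apply (le_one P r).
    (* [tau] is chosen separately for each representative, so single-valuedness uses [fh_inj]: equal
       arguments have equal [h]-values, hence nodes with the same value under [fh]. *)
    + intros q x z z' Lq H1 H2. apply (Hm _ _ _ _ H1). intros r i Lr Ex Ez. down Lr.
      apply (Hm _ _ _ _ H2). intros r' i' Lr' Ex' Ez'. down Lr'.
      frw Ez. frw Ez'. frwin Ex Ex'. apply check_eq in Ex'.
      destruct (Htau _ (Vfam_mem kappa i)) as [_ K]. destruct (Htau _ (Vfam_mem kappa i')) as [_ K'].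
      apply (frc_mono _ _ _ _ _ Lq) in K. apply (frc_mono _ _ _ _ _ Lq) in K'.
      assert (Ec : r' ||- check (h (Vfam kappa i)) == check (h (Vfam kappa i'))).
      { apply check_eq, Eh; [apply Vfam_mem|exact Ex']. }
      frwin Ec K. eapply fh_inj; eassumption.
  - fall x. fall z. fimp H. apply (Hm _ _ _ _ H). intros r i Lr _ Ez. frw Ez.
    apply HL. destruct (Htau _ (Vfam_mem kappa i)) as [K _].
    split; apply frc_top; apply K.
  - fall x. fall x'. fall z. fimp H. fand H as [H1 H2].
    apply (Hm _ _ _ _ H1). intros r i Lr Ex Ez. down Lr.
    apply (Hm _ _ _ _ H2). intros r' i' Lr' Ex' Ez'. down Lr'.
    frw Ex. frw Ex'. apply check_eq.
    destruct (Htau _ (Vfam_mem kappa i)) as [_ K]. destruct (Htau _ (Vfam_mem kappa i')) as [_ K'].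
    apply (frc_mono _ _ _ _ _ L0) in K. apply (frc_mono _ _ _ _ _ L0) in K'.
    apply Ih; [apply Vfam_mem..|]. frwin Ez Ez'.
    apply frc_eq_sym in Ez'. frwin Ez' K'. eapply fh_check_fun; eassumption.
Qed.

(** The code of [t] comes from the set [G0 t] of all pairs of a condition and the value it decides
    for [fh t], a subset of [Vprod xP lam]. The power set of this product is small, and [d] is an
    ordinal into which it injects. *)
Lemma level_code_of_injection : exists d (G : name P -> V), Vmem d kappa /\
  forall t, node top t a -> Vmem (G t) d /\
    forall u, node top u a -> (Veq (G t) (G u) <-> top ||- t == u).
Proof.
  (* [b] is to bound all values decided by the condition coded by [v]. Choosing such bounds for all
     [v] in the small set [xP] and bounding them in turn gives [lam]. *)
  set (bd := fun v b => Vmem b kappa /\ forall p t c, Veq v (e p) -> node top t a ->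
     Vmem c kappa -> p ||- maps fh t (check c) -> Vmem c b).
  destruct (small_bounded kappa h_kappa xP (fun v => epsilon (inhabits kappa) (bd v)))
    as (lam & Hlam & Blam).
  { apply small_iff; assumption. }
  { intros v v' _ E. replace (bd v') with (bd v); [reflexivity|].
    extensionality b. apply propositional_extensionality. unfold bd.
    split; intros [H K]; (split; [exact H|]); intros p t c Ev; apply K;
      rewrite <- Ev; [|symmetry]; exact E. }
  { intros v Hv. destruct (e_surj v Hv) as [p Hp].
    assert (K : bd v (epsilon (inhabits kappa) (bd v))); [|apply K].
    apply epsilon_spec. destruct (fh_values_bounded p) as (b & Hb & K). exists b.
    split; [exact Hb|]. intros p' t c Ev. assert (p' = p) as ->; [|apply K].
    apply e_inj. rewrite <- Ev, <- Hp. reflexivity. }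
  assert (Hval : forall p t c, node top t a -> Vmem c kappa -> p ||- maps fh t (check c) ->
    Vmem c lam).
  { intros p t c Nt Hc K. pose proof (Blam (e p) (e_mem p)) as Hb.
    eapply (proj1 (kappa_Ord kappa h_kappa lam Hlam)); [exact Hb|].
    assert (B : bd (e p) (epsilon (inhabits kappa) (bd (e p)))).
    { apply epsilon_spec. destruct (fh_values_bounded p) as (b & Hb' & K'). exists b.
      split; [exact Hb'|]. intros p' t' c' Ev. apply e_inj in Ev. subst p'. apply K'. }
    destruct B as [_ B]. apply (B p t c); auto. reflexivity. }
  set (G0 := fun t => Vsep (Vprod xP lam)
     (fun z => exists p c, Veq z (opair (e p) c) /\ p ||- maps fh t (check c))).
  assert (Cg : forall t, Vcongr
     (fun z => exists p c, Veq z (opair (e p) c) /\ p ||- maps fh t (check c))).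
  { intros t z z' E (p & c & Ez & K). exists p, c. rewrite <- E. auto. }
  assert (HS : small kappa (Vpow (Vprod xP lam))).
  { apply small_pow; [exact h_kappa|]. apply small_prod; [exact h_kappa| |].
    - apply small_iff; assumption.
    - apply small_mem, Hlam. }
  destruct HS as (d & Hd & j & Ej & Hj & Ij).
  assert (HG0 : forall t, Vmem (G0 t) (Vpow (Vprod xP lam))).
  { intros t. apply Vmem_pow. intros z Hz. apply Vmem_sep in Hz; [|apply Cg]. tauto. }
  exists d, (fun t => j (G0 t)). split; [exact Hd|]. intros t Nt. split; [apply Hj, HG0|].
  intros u Nu. split.
  (* Below any [q] some [r] decides [fh t]; as the codes agree, [r] decides the same value for
     [fh u], and so forces [t] and [u] to be equal. *)
  - intros E. apply Ij in E; [|apply HG0..]. apply frc_dense. intros q Lq.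
    destruct (fh_value top t Nt q Lq) as (r & c & Lr & Hc & K).
    exists r. split; [exact Lr|].
    assert (M : Vmem (opair (e r) c) (G0 t)).
    { apply Vmem_sep; [apply Cg|]. split.
      - apply Vmem_prod. exists (e r), c. split; [apply e_mem|].
        split; [exact (Hval r t c Nt Hc K)|reflexivity].
      - exists r, c. split; [reflexivity|exact K]. }
    rewrite E in M. apply Vmem_sep in M as [_ (p' & c' & Eo & K')]; [|apply Cg].
    apply opair_inj in Eo as [Ee Ec]. apply e_inj in Ee. subst p'.
    assert (Ec' : (r : world NM) ||- check c == check c') by (apply check_eq, Ec).
    frwin Ec' K. eapply fh_inj; eassumption.
  - intros E. apply Ej; [apply HG0|]. apply Vext. intros z.
    unfold G0. rewrite !Vmem_sep by apply Cg.
    split; intros [H (p & c & Ez & K)]; (split; [exact H|]); exists p, c; (split; [exact Ez|]).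
    + pose proof (frc_top p _ E) as E'. frwin E' K. exact K.
    + pose proof (frc_top p _ E) as E'. frw E'. exact K.
Qed.
End LevelCode.

(** Separation gives a name for the level of [T], and fullness replaces its forced injection into
    [kappa] by a single name [fh]. *)
Lemma level_code a : Vmem a kappa -> exists d (G : name P -> V), Vmem d kappa /\
  forall t, node top t a -> Vmem (G t) d /\
    forall u, node top u a -> (Veq (G t) (G u) <-> top ||- t == u).
Proof.
  intros Ha.
  destruct (frc_separation _ NM (fun t => fun_on t (check a))) with T as [L HL].
  { change (congruent (M := NM) (fun t => fun_on t (check a))). congr_tac. }
  assert (HC : top ||- card_lt L (check kappa)).
  { pose proof h_T as H. unfold regular_tree in H. fand H as [_ [_ [H _]]].
    fspec H (check (P := P) a). apply (fun H => frc_mp _ _ _ H (proj2 (check_mem _ _ _) Ha)) in H.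
    fspec H L. apply (frc_mp _ _ _ H). unfold is_level. fall t. apply frc_iff. intros q _.
    rewrite HL, frc_and. reflexivity. }
  unfold card_lt in HC. fand HC as [HI HN]. unfold injects in HI.
  apply frc_fullness in HI; [|congr_tac]. destruct HI as [fh HI]. fand HI as [HF HI].
  apply (level_code_of_injection a L fh HL HF).
  - intros p s t z Hs Ht. pose proof (frc_top p _ HI) as K. fspec K s. fspec K t. fspec K z.
    apply (frc_mp _ _ _ K). fsplit; assumption.
  - intros p H. rewrite frc_not in HN. exact (HN p (le_one P p) H).
Qed.

Lemma succ_len a b : Vmem a kappa -> Vmem b a -> Vmem (Vsucc b) kappa.
Proof.
  intros Ha Hb. apply kappa_succ; [exact h_kappa|]. exact (kappa_trans kappa h_kappa a b Ha Hb).
Qed.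

Lemma node_congr p t a b : Veq a b -> node p t a -> node p t b.
Proof.
  intros E [H K]. split; [exact H|].
  assert (E' : p ||- check a == check b) by (apply check_eq, E). frwin E' K. exact K.
Qed.

Lemma node_len p t a b : node p t a -> node p t b -> Veq a b.
Proof. intros [_ F] [_ G]. apply (check_eq p). eapply fun_dom_unique; eassumption. Qed.

Lemma node_eq p s t a : node p s a -> p ||- s == t -> node p t a.
Proof. intros [H K] E. frwin E H. frwin E K. split; assumption. Qed.

Lemma node_proper p s t b a : Vmem b kappa -> Vmem a kappa -> node p s b -> node p t a ->
  (p ||- proper_init_seg s t <-> p ||- subset s t /\ Vmem b a).
Proof.
  intros Hb Ha Ns Nt. unfold proper_init_seg. rewrite frc_and.
  rewrite (node_init_seg p s t b a Hb Ns Nt). split; intros [S K]; (split; [exact S|]).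
  - destruct (kappa_compare kappa h_kappa a b Ha Hb) as [H|H]; [|exact H].
    exfalso. rewrite frc_not in K. apply (K p (wle_refl _ _ _)).
    eapply node_subset_eq; eassumption.
  - fnot E. apply (Vmem_irrefl a). assert (Veq b a) as H; [|rewrite <- H at 1; exact K].
    apply (node_len q t); [|eapply node_mono; eassumption].
    apply (node_eq q s); [eapply node_mono; eassumption|exact E].
Qed.

Lemma node_subset_of_len p s t u b c a : node p s b -> node p t c -> node p u a ->
  p ||- subset s u -> p ||- subset t u -> Vsub b c -> p ||- subset s t.
Proof.
  intros [_ Fs] [_ Ft] [_ Fu] S1 S2 H.
  eapply fun_subset_of_dom; [exact Fs|exact Ft|exact Fu|exact S1|exact S2|].
  apply check_subset, H.
Qed.

(** Each level has its own coding, so the length of a node is chosen first; it is unique up to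
    [Veq]. Since [lc] does not distinguish [Veq] lengths, the coding selected is literally that of
    the level. *)
Lemma code_exists : exists code : name P -> V, forall a, Vmem a kappa ->
  exists d, Vmem d kappa /\ forall t, node top t a -> Vmem (code t) d /\
    forall u, node top u a -> (Veq (code t) (code u) <-> top ||- t == u).
Proof.
  set (lc := fun a (dG : V * (name P -> V)) => Vmem (fst dG) kappa /\
    forall t, node top t a -> Vmem (snd dG t) (fst dG) /\
    forall u, node top u a -> (Veq (snd dG t) (snd dG u) <-> top ||- t == u)).
  set (ch := fun a => epsilon (inhabits (kappa, fun _ : name P => kappa)) (lc a)).
  assert (Hch : forall a, Vmem a kappa -> lc a (ch a)).
  { intros a Ha. apply epsilon_spec. destruct (level_code a Ha) as (d & G & H).
    exists (d, G). exact H. }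
  assert (lc_ext : forall a b, Veq a b -> ch a = ch b).
  { intros a b E. unfold ch. f_equal. extensionality dG. apply propositional_extensionality.
    assert (N : forall t, node top t a <-> node top t b).
    { intros t. split; apply node_congr; [|symmetry]; exact E. }
    unfold lc. split; intros [H K]; (split; [exact H|]); intros t Nt; apply N in Nt;
      destruct (K t Nt) as [K1 K2]; (split; [exact K1|]); intros u Nu; apply N in Nu; auto. }
  set (len := fun t => epsilon (inhabits kappa) (node top t)).
  exists (fun t => snd (ch (len t)) t). intros a Ha.
  assert (Hlen : forall t, node top t a -> ch (len t) = ch a).
  { intros t Nt. apply lc_ext. apply (node_len top t); [|exact Nt].
    apply epsilon_spec. eauto. }
  destruct (Hch a Ha) as [H K]. exists (fst (ch a)). split; [exact H|].
  intros t Nt. rewrite (Hlen t Nt). destruct (K t Nt) as [K1 K2]. split; [exact K1|].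
  intros u Nu. rewrite (Hlen u Nu). apply K2, Nu.
Qed.

(** The choice is made before [p] and [a] are given, which the uniformity of [restriction_exists]
    allows. *)
Lemma restrict_exists : exists res : name P -> V -> name P, forall p t a b,
  Vmem a kappa -> Vmem b kappa -> Vsub b a -> node p t a ->
  node p (res t b) b /\ p ||- subset (res t b) t.
Proof.
  set (R := fun t b s => forall p d, p ||- fun_on t d -> p ||- subset (check b) d ->
    p ||- fun_on s (check b) /\ p ||- subset s t).
  exists (fun t b => epsilon (inhabits t) (R t b)). intros p t a b Ha Hb S [Ht Ft].
  assert (K : R t b (epsilon (inhabits t) (R t b))).
  { apply epsilon_spec. apply restriction_exists. }
  destruct (K p (check a) Ft) as [K1 K2]; [apply check_subset, S|].
  split; [|exact K2]. split; [|exact K1].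
  eapply (tree_closed kappa T); [apply T_tree|exact Ht| |exact K1|exact K2].
  eapply Ord_mem; eassumption.
Qed.

(** The conditions deciding whether [v] is a node of length [c] extending [t] are dense. Where it is
    one, [v] is extended to level [b]; where it is not, [t] is extended. Fullness merges these local
    choices into one name [y]. *)
Lemma uniform_extend t a b v : node top t a -> Vmem a kappa -> Vmem b kappa -> Vsub a b ->
  forall c, Vsub c b ->
  exists y, node top y b /\ top ||- subset t y /\
    forall p, node p v c -> p ||- subset t v -> p ||- subset v y.
Proof.
  intros Nt Ha Hb S c Sc.
  assert (H : top ||- \ex y, ((y \in T /\ fun_on y (check b) /\ subset t y) /\
    ((v \in T /\ fun_on v (check c) /\ subset t v) \imp subset v y))).
  { apply (frc_em top (v \in T /\ fun_on v (check c) /\ subset t v)%form); intros q L K.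
    - fand K as [K1 [K2 K3]].
      pose proof (node_extend q v c b (conj K1 K2) Hb Sc) as E. fex E as y E. fand E as [E1 [E2 E3]].
      fwit y. fsplit; [fsplit; [exact E1|fsplit; [exact E2|]]|].
      + eapply subset_trans; eassumption.
      + apply frc_imp. intros r Lr _. eapply frc_mono; eassumption.
    - pose proof (node_extend q t a b (node_mono _ _ _ _ L Nt) Hb S) as E. fex E as y E.
      fwit y. fsplit; [exact E|]. fimp K'. eapply frc_absurd; eassumption. }
  apply frc_fullness in H; [|congr_tac]. destruct H as [y H]. rewrite !frc_and in H.
  destruct H as [[H1 [H2 H3]] H4]. exists y. split; [split; assumption|]. split; [exact H3|].
  intros p [N1 N2] K. pose proof (frc_top p _ H4) as J. apply (frc_mp _ _ _ J).
  fsplit; [exact N1|fsplit; assumption].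
Qed.

(** * Sequences of codes *)

Section Coding.
Variables (code : name P -> V) (res : name P -> V -> name P).
Hypothesis code_spec : forall a, Vmem a kappa ->
  exists d, Vmem d kappa /\ forall t, node top t a -> Vmem (code t) d /\
    forall u, node top u a -> (Veq (code t) (code u) <-> top ||- t == u).
Hypothesis res_spec : forall p t a b,
  Vmem a kappa -> Vmem b kappa -> Vsub b a -> node p t a ->
  node p (res t b) b /\ p ||- subset (res t b) t.

(** Position [b] records the restriction that already contains the value at [b]; restrictions to [b]
    would miss the last value of a node of successor length. A node of limit length is the union of
    the recorded restrictions, so the sequence determines it without using a code of the node
    itself. *)
Definition seq (t : name P) (a : V) : V := fset a (fun b => code (res t (Vsucc b))).

Lemma code_mem t a : Vmem a kappa -> node top t a -> Vmem (code t) kappa.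
Proof.
  intros Ha Nt. destruct (code_spec a Ha) as (d & Hd & K).
  eapply kappa_trans; [exact h_kappa|exact Hd|]. apply K, Nt.
Qed.

Lemma code_eq t u a : Vmem a kappa -> node top t a -> node top u a ->
  (Veq (code t) (code u) <-> top ||- t == u).
Proof. intros Ha Nt Nu. destruct (code_spec a Ha) as (d & Hd & K). apply K; assumption. Qed.

Lemma res_succ t a b : Vmem a kappa -> node top t a -> Vmem b a ->
  node top (res t (Vsucc b)) (Vsucc b) /\ top ||- subset (res t (Vsucc b)) t.
Proof.
  intros Ha Nt Hb. apply (res_spec top t a); [exact Ha| |apply succ_Vsub with kappa; assumption|exact Nt].
  exact (succ_len a b Ha Hb).
Qed.

Lemma res_succ_eq t u a a' b b' : Vmem a kappa -> Vmem a' kappa -> node top t a -> node top u a' ->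
  top ||- subset t u -> Vmem b a -> Veq b b' ->
  top ||- res t (Vsucc b) == res u (Vsucc b').
Proof.
  intros Ha Ha' Nt Nu S Hb E.
  assert (Hb' : Vmem b' a').
  { rewrite <- E. apply (node_subset_len _ _ _ _ _ Nt Nu S), Hb. }
  destruct (res_succ t a b Ha Nt Hb) as [N1 S1]. destruct (res_succ u a' b' Ha' Nu Hb') as [N2 S2].
  assert (Es : Veq (Vsucc b) (Vsucc b')) by (rewrite E; reflexivity).
  apply (node_subset_eq _ _ _ _ _ N1 N2); [rewrite Es; intros z; auto|].
  apply (node_subset_of_len _ _ _ _ _ _ _ N1 N2 Nu); [|exact S2|rewrite Es; intros z; auto].
  eapply subset_trans; eassumption.
Qed.

Lemma seq_ext t a : Vmem a kappa -> node top t a ->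
  ext_on a (fun b => code (res t (Vsucc b))).
Proof.
  intros Ha Nt b b' Hb E. destruct (res_succ t a b Ha Nt Hb) as [N1 S1].
  assert (Q : top ||- res t (Vsucc b) == res t (Vsucc b')).
  { apply (res_succ_eq t t a a); try assumption. apply subset_refl. }
  apply (code_eq _ _ (Vsucc b)); [|exact N1|eapply node_eq; eassumption|exact Q].
  exact (succ_len a b Ha Hb).
Qed.

Lemma seq_opair t a b c : Vmem a kappa -> node top t a ->
  (Vmem (opair b c) (seq t a) <-> Vmem b a /\ Veq c (code (res t (Vsucc b)))).
Proof. intros Ha Nt. apply fset_opair, seq_ext; assumption. Qed.

Lemma seq_fun t a : Vmem a kappa -> node top t a -> sat (fun_from_to (seq t a) a kappa).
Proof.
  intros Ha Nt. apply fset_fun_from_to; [apply seq_ext; assumption|].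
  intros b Hb. apply (code_mem _ (Vsucc b)); [|apply (res_succ t a b Ha Nt Hb)].
  exact (succ_len a b Ha Hb).
Qed.

Lemma seq_fun_on t a : Vmem a kappa -> node top t a -> sat (fun_on (seq t a) a).
Proof. intros Ha Nt. apply (seq_fun t a Ha Nt). Qed.

Lemma seq_sub t u a a' : Vmem a kappa -> Vmem a' kappa -> node top t a -> node top u a' ->
  (Vsub (seq t a) (seq u a') <-> top ||- subset t u).
Proof.
  intros Ha Ha' Nt Nu. split.
  - intros S. destruct Nt as [Ht Ft]. apply (fun_subset _ _ _ _ Ft). intros q x y L Hx Hm.
    apply (mem_check_elim _ _ _ _ Hx). intros r b Lr Hb E. down Lr. frw E. frwin E Hm.
    assert (Nt : node top t a) by (split; assumption).
    (* Comparing position [b] of the two sequences shows that [t] and [u] have the same restriction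
       to [Vsucc b], which contains the value of [t] at [b]. *)
    assert (K : Vmem (opair b (code (res t (Vsucc b)))) (seq u a')).
    { apply S. apply seq_opair; [exact Ha|exact Nt|]. split; [exact Hb|reflexivity]. }
    apply seq_opair in K as [Hb' K]; [|exact Ha'|exact Nu].
    destruct (res_succ t a b Ha Nt Hb) as [N1 S1].
    destruct (res_succ u a' b Ha' Nu Hb') as [N2 S2].
    apply (code_eq _ _ (Vsucc b)) in K; [|exact (succ_len a b Ha Hb)|exact N1|exact N2].
    apply (maps_subset _ (res u (Vsucc b))); [apply frc_top, S2|].
    apply (frc_top r) in K. apply frc_eq_sym in K. frw K.
    apply (maps_restrict _ _ t (check (Vsucc b)) (check a)).
    + apply frc_top, N1.
    + apply frc_top, Ft.
    + apply frc_top, S1.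
    + apply check_mem, Vmem_succ. right. reflexivity.
    + exact Hm.
  - intros S z Hz. apply fset_elem in Hz as (b & Hb & Ez). rewrite Ez.
    apply seq_opair; [exact Ha'|exact Nu|].
    split; [apply (node_subset_len _ _ _ _ _ Nt Nu S), Hb|].
    assert (Q : top ||- res t (Vsucc b) == res u (Vsucc b)).
    { apply (res_succ_eq t u a a'); try assumption. reflexivity. }
    destruct (res_succ t a b Ha Nt Hb) as [N1 _].
    apply (code_eq _ _ (Vsucc b)); [|exact N1|eapply node_eq; eassumption|exact Q].
    exact (succ_len a b Ha Hb).
Qed.

Lemma seq_eq t u a a' : Vmem a kappa -> Vmem a' kappa -> node top t a -> node top u a' ->
  (Veq (seq t a) (seq u a') <-> top ||- t == u).
Proof.
  intros Ha Ha' Nt Nu. split.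
  - intros E. apply subset_antisym.
    + apply (seq_sub t u a a' Ha Ha' Nt Nu). rewrite E. intros z; auto.
    + apply (seq_sub u t a' a Ha' Ha Nu Nt). rewrite E. intros z; auto.
  - intros E. apply Vsub_antisym; apply seq_sub; try assumption; apply eq_subset;
      [|apply frc_eq_sym]; exact E.
Qed.

Lemma seq_init_seg t u a a' : Vmem a kappa -> Vmem a' kappa -> node top t a -> node top u a' ->
  (sat (init_seg (seq t a) (seq u a')) <-> Vsub (seq t a) (seq u a')).
Proof.
  intros Ha Ha' Nt Nu. rewrite <- sat_subset. split.
  - exact (init_seg_subset (M := ground) tt _ _).
  - intros S. refine (subset_init_seg (M := ground) tt _ _ a a' _ _ _ S).
    + apply seq_fun_on; assumption.
    + apply sat_ordinal. eapply Ord_mem; eassumption.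
    + apply seq_fun_on; assumption.
Qed.

(** * The set of code sequences as a regular tree *)

(** The nodes range over a type of names, not over a set of [V]. Sequences of codes are subsets of
    [Vprod kappa kappa], so separation from its power set collects them into one set. *)
Definition derived : V := Vsep (Vpow (Vprod kappa kappa))
  (fun s => exists t a, Vmem a kappa /\ node top t a /\ Veq s (seq t a)).

Lemma derived_mem s : Vmem s derived <->
  exists t a, Vmem a kappa /\ node top t a /\ Veq s (seq t a).
Proof.
  unfold derived. rewrite Vmem_sep.
  - split; [tauto|]. intros (t & a & Ha & Nt & E). split; [|eauto].
    apply Vmem_pow. rewrite E. intros z Hz. apply fset_elem in Hz as (b & Hb & Ez).
    apply Vmem_prod. exists b, (code (res t (Vsucc b))).
    split; [exact (kappa_trans kappa h_kappa a b Ha Hb)|]. split; [|exact Ez].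
    apply (code_mem _ (Vsucc b)); [|apply (res_succ t a b Ha Nt Hb)].
    exact (succ_len a b Ha Hb).
  - intros x y E (t & a & H1 & H2 & H3). exists t, a. rewrite <- E. auto.
Qed.

Lemma seq_mem t a : Vmem a kappa -> node top t a -> Vmem (seq t a) derived.
Proof. intros Ha Nt. apply derived_mem. exists t, a. split; [exact Ha|]. split; [exact Nt|reflexivity]. Qed.

Lemma sat_congr phi x y : congruent (M := ground) phi -> Veq x y -> sat (phi x) -> sat (phi y).
Proof. intros C E. exact (C tt x y E). Qed.

Lemma derived_fun_on s t a b : Vmem a kappa -> node top t a -> Veq s (seq t a) ->
  sat (fun_on s b) -> Veq b a.
Proof.
  intros Ha Nt E F. refine (fun_dom_unique (M := ground) tt s b a F _).
  apply (sat_congr (fun s => fun_on s a) (seq t a)); [congr_tac|symmetry; exact E|].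
  apply seq_fun_on; assumption.
Qed.

Lemma node_exists a : Vmem a kappa -> exists t, node top t a.
Proof.
  (* An extension of the empty family is just a node of length [a]; it exists because the empty
     chain too lies on a maximal branch. *)
  intros Ha. destruct (family_extend Empty_set (fun i => match i with end)
    (fun i => match i with end) a Ha) as (y & Ny & _); [intros []..|]. eauto.
Qed.

(** The entry at a position depends only on the restriction of [t] just past it, so cutting the
    sequence at [b] gives the sequence of the restriction of [t] to [b]. This makes the set of
    sequences closed under initial segments. *)
Lemma derived_init_seg s t a : Vmem a kappa -> node top t a -> sat (init_seg s (seq t a)) ->
  exists b, Vmem b kappa /\ Vsub b a /\ Veq s (seq (res t b) b).
Proof.
  intros Ha Nt HI.
  pose proof (seq_fun_on t a Ha Nt) as F.
  assert (Oa : sat (ordinal a)) by (apply sat_ordinal; eapply Ord_mem; eassumption).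
  pose proof (init_seg_dom (M := ground) tt s (seq t a) a HI F Oa) as K.
  rewrite ground_frc, sat_ex in K. destruct K as (b & Ob & Sb & Fs).
  apply sat_ordinal in Ob. apply sat_subset in Sb.
  assert (Hb : Vmem b kappa) by (apply (Ord_sub_mem b a); assumption).
  exists b. split; [exact Hb|]. split; [exact Sb|].
  destruct (res_spec top t a b Ha Hb Sb Nt) as [Nr Sr].
  pose proof (seq_fun_on _ _ Hb Nr) as Fr.
  refine (fun_subset_eq (M := ground) tt s _ b Fs Fr _).
  refine (fun_subset_of_dom (M := ground) tt _ _ _ b b a Fs Fr F _ _ _).
  - exact (init_seg_subset (M := ground) tt _ _ HI).
  - apply sat_subset. apply seq_sub; assumption.
  - apply subset_refl.
Qed.

Lemma derived_tree : sat (is_tree derived kappa).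
Proof.
  unfold is_tree. split.
  - intros s. rewrite sat_imp. intros Hs. apply derived_mem in Hs as (t & a & Ha & Nt & E).
    apply sat_ex. exists a. split; [exact Ha|].
    apply (sat_congr (fun s => fun_from_to s a kappa) (seq t a)); [congr_tac|symmetry; exact E|].
    apply seq_fun; assumption.
  - intros s. rewrite sat_imp. intros Hs s'. rewrite sat_imp. intros HI.
    apply derived_mem in Hs as (t & a & Ha & Nt & E).
    apply (sat_congr (fun s => init_seg s' s) s (seq t a)) in HI; [|congr_tac|exact E].
    apply (derived_init_seg _ _ _ Ha Nt) in HI as (b & Hb & Sb & E').
    apply derived_mem. exists (res t b), b. split; [exact Hb|]. split; [|exact E'].
    apply (res_spec top t a b); assumption.
Qed.

Lemma derived_height : sat (has_height derived kappa).
Proof.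
  unfold has_height. split; [apply sat_ordinal; exact kord|]. split.
  - intros a. rewrite sat_imp. intros Ha. apply sat_ex.
    destruct (node_exists a Ha) as [t Nt]. exists (seq t a).
    split; [apply seq_mem; assumption|apply seq_fun_on; assumption].
  - cbn [sat]. rewrite sat_ex. intros [s [Hs F]].
    apply derived_mem in Hs as (t & a & Ha & Nt & E).
    pose proof (derived_fun_on _ _ _ _ Ha Nt E F) as K. rewrite <- K in Ha.
    exact (Vmem_irrefl _ Ha).
Qed.

(** A sequence on level [a] is determined by the code of any node of length [a] that it represents,
    and all these codes lie in one [d] below [kappa]. *)
Lemma derived_levels a L : Vmem a kappa -> sat (is_level L derived a) -> sat (card_lt L kappa).
Proof.
  intros Ha HL. apply small_iff; [exact h_kappa|].
  destruct (code_spec a Ha) as (d & Hd & K). exists d. split; [exact Hd|].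
  set (R := fun s t => node top t a /\ Veq s (seq t a)).
  assert (HR : forall s, Vmem s L -> R s (epsilon (inhabits T) (R s))).
  { intros s Hs. apply epsilon_spec. specialize (HL s). rewrite sat_iff in HL.
    destruct (proj1 HL Hs) as [Hd' F]. apply derived_mem in Hd' as (t & b & Hb & Nt & E).
    pose proof (derived_fun_on _ _ _ _ Hb Nt E F) as Eab.
    exists t. split; [apply (node_congr _ _ b); [symmetry; exact Eab|exact Nt]|].
    rewrite E. apply seq_eq; try assumption; [|apply frc_eq_refl].
    apply (node_congr _ _ b); [symmetry; exact Eab|exact Nt]. }
  exists (fun s => code (epsilon (inhabits T) (R s))). split; [|split].
  - intros s s' Hs E. destruct (HR s Hs) as [N1 E1].
    assert (Hs' : Vmem s' L) by (rewrite <- E; exact Hs). destruct (HR s' Hs') as [N2 E2].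
    apply (code_eq _ _ a); try assumption. apply (seq_eq _ _ a a); try assumption.
    rewrite <- E1, <- E2. exact E.
  - intros s Hs. apply K, HR, Hs.
  - intros s s' Hs Hs' E. destruct (HR s Hs) as [N1 E1]. destruct (HR s' Hs') as [N2 E2].
    rewrite E1, E2. apply seq_eq; try assumption. apply (code_eq _ _ a); assumption.
Qed.

Lemma derived_branch b : sat (is_max_branch b derived) -> sat (has_length b kappa).
Proof.
  intros [[Sb Cb] Mb]. apply sat_subset in Sb.
  assert (Hb : forall s, Vmem s b -> exists t a, Vmem a kappa /\ node top t a /\ Veq s (seq t a)).
  { intros s Hs. apply derived_mem, Sb, Hs. }
  assert (Cmp : forall s s', Vmem s b -> Vmem s' b -> Vsub s s' \/ Vsub s' s).
  { intros s s' Hs Hs'. specialize (Cb s). rewrite sat_imp in Cb. specialize (Cb Hs s').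
    rewrite sat_imp, sat_or in Cb. rewrite <- !sat_subset.
    destruct (Cb Hs') as [C|C]; [left|right]; exact (init_seg_subset (M := ground) tt _ _ C). }
  (* Adding such a sequence to [b] gives a chain [c] again, so maximality puts the sequence into
     [b]. *)
  assert (Max : forall t a, Vmem a kappa -> node top t a ->
    (forall s, Vmem s b -> Vsub s (seq t a) \/ Vsub (seq t a) s) -> Vmem (seq t a) b).
  { intros t a Ha Nt C.
    set (c := Vsep derived (fun z => Vmem z b \/ Veq z (seq t a))).
    assert (Hc : forall z, Vmem z c <-> Vmem z b \/ Veq z (seq t a)).
    { intros z. unfold c. rewrite Vmem_sep.
      - split; [tauto|]. intros H. split; [|exact H]. destruct H as [H|H]; [apply Sb, H|].
        rewrite H. apply seq_mem; assumption.
      - intros x y E. rewrite E. auto. }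
    assert (E : Veq c b).
    { specialize (Mb c). rewrite sat_imp in Mb. apply Mb. split; [split|].
      - apply sat_subset. intros z Hz. unfold c in Hz. apply Vmem_sep in Hz; [tauto|].
        intros x y E. rewrite E. auto.
      - assert (I : forall s s', Vmem s c -> Vmem s' c -> Vsub s s' -> sat (init_seg s s')).
        { assert (D : forall s, Vmem s c -> exists t a, Vmem a kappa /\ node top t a /\ Veq s (seq t a)).
          { intros s Hs. apply Hc in Hs as [Hs|Hs]; [apply Hb, Hs|eauto]. }
          intros s s' Hs Hs' S. destruct (D s Hs) as (u & b1 & H1 & N1 & E1).
          destruct (D s' Hs') as (u' & b2 & H2 & N2 & E2).
          apply (sat_congr (fun x => init_seg x s') (seq u b1)); [congr_tac|symmetry; exact E1|].
          apply (sat_congr (fun x => init_seg (seq u b1) x) (seq u' b2)); [congr_tac|symmetry; exact E2|].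
          apply seq_init_seg; try assumption. rewrite <- E1, <- E2. exact S. }
        intros s. rewrite sat_imp. intros Hs s'. rewrite sat_imp, sat_or. intros Hs'.
        assert (Vsub s s' \/ Vsub s' s) as [S|S]; [|left; apply I; assumption|right; apply I; assumption].
        apply Hc in Hs, Hs'. destruct Hs as [Hs|Hs], Hs' as [Hs'|Hs'].
        + auto.
        + rewrite Hs'. auto.
        + rewrite Hs. destruct (C s' Hs'); auto.
        + left. rewrite Hs, Hs'. intros z; auto.
      - apply sat_subset. intros z Hz. apply Hc. auto. }
    rewrite <- E. apply Hc. right. reflexivity. }
  unfold has_length. split; [apply sat_ordinal; exact kord|]. intros a. rewrite sat_iff, sat_ex.
  cbn [sat]. split.
  2:{ intros (s & Hs & F). destruct (Hb s Hs) as (t & a' & Ha' & Nt & E).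
      rewrite (derived_fun_on _ _ _ _ Ha' Nt E F). exact Ha'. }
  intros Ha.
  (* Either some element of [b] has length at least [a], and its restriction to [a] belongs to [b];
     or all are shorter, and [family_extend] gives a common extension of length [a]. *)
  destruct (classic (exists s t a', Vmem s b /\ Vmem a' kappa /\ node top t a' /\
    Veq s (seq t a') /\ Vsub a a')) as [(s & t & a' & Hs & Ha' & Nt & E & Saa)|N].
  - destruct (res_spec top t a' a Ha' Ha Saa Nt) as [Nr Sr].
    exists (seq (res t a) a). split; [|apply seq_fun_on; assumption].
    apply Max; [exact Ha|exact Nr|]. intros s' Hs'.
    assert (Sa : Vsub (seq (res t a) a) s).
    { rewrite E. apply seq_sub; assumption. }
    destruct (Cmp s' s Hs' Hs) as [S|S]; [|right; intros z Hz; auto].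
    destruct (Hb s' Hs') as (u & c & Hc & Nu & E'). rewrite E' in S |- *. rewrite E in S.
    apply seq_sub in S; [|assumption..].
    destruct (kappa_compare kappa h_kappa c a Hc Ha) as [H|H]; [left|right]; apply seq_sub; try assumption.
    + apply (node_subset_of_len _ _ _ t c a a'); assumption.
    + apply (node_subset_of_len _ _ _ t a c a'); try assumption.
      apply (mem_Vsub kappa); assumption.
  - set (R := fun s (ta : name P * V) => Vmem (snd ta) kappa /\ node top (fst ta) (snd ta) /\
      Veq s (seq (fst ta) (snd ta))).
    set (ch := fun s => epsilon (inhabits (T, kappa)) (R s)).
    assert (Hch : forall s, Vmem s b -> R s (ch s)).
    { intros s Hs. apply epsilon_spec. destruct (Hb s Hs) as (t & c & K). exists (t, c). exact K. }
    destruct (family_extend (Vcarrier b) (fun i => fst (ch (Vfam b i)))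
      (fun i => snd (ch (Vfam b i))) a Ha) as (y & Ny & Hy).
    + intros i. destruct (Hch _ (Vfam_mem b i)) as (H1 & H2 & H3). split; [exact H2|].
      split; [exact H1|]. destruct (kappa_compare kappa h_kappa a (snd (ch (Vfam b i))) Ha H1) as [H|H].
      * exfalso. apply N. exists (Vfam b i), (fst (ch (Vfam b i))), (snd (ch (Vfam b i))).
        repeat split; try assumption; try apply H2. apply Vfam_mem.
      * apply (mem_Vsub kappa); assumption.
    + intros i j. destruct (Hch _ (Vfam_mem b i)) as (H1 & H2 & H3).
      destruct (Hch _ (Vfam_mem b j)) as (K1 & K2 & K3).
      destruct (Cmp _ _ (Vfam_mem b i) (Vfam_mem b j)) as [S|S]; rewrite H3, K3 in S.
      * left. exact (proj1 (seq_sub _ _ _ _ H1 K1 H2 K2) S).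
      * right. exact (proj1 (seq_sub _ _ _ _ K1 H1 K2 H2) S).
    + exists (seq y a). split; [|apply seq_fun_on; assumption]. apply Max; [exact Ha|exact Ny|].
      intros s Hs. left. apply Vmem_fam in Hs as [i Hi]. rewrite Hi.
      destruct (Hch _ (Vfam_mem b i)) as (H1 & H2 & H3). rewrite H3.
      apply seq_sub; try assumption. apply Hy.
Qed.

(* It suffices that the two extensions differ below a single condition. *)
Lemma derived_perfect : sat (perfect derived).
Proof.
  unfold perfect. intros s. rewrite sat_imp. intros Hs.
  apply derived_mem in Hs as (t & a & Ha & Nt & E).
  pose proof h_T as H. unfold regular_tree, perfect in H. fand H as [_ [_ [_ [_ H]]]].
  fspec H t. pose proof (frc_mp _ _ _ H (proj1 Nt)) as K. clear H.
  destruct (frc_ex_dense _ _ K top (wle_refl _ _ _)) as (p1 & v & _ & K1). clear K.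
  fand K1 as [Hv K1].
  destruct (frc_ex_dense _ _ K1 p1 (wle_refl _ _ _)) as (p2 & w & L2 & K2). clear K1.
  down L2. fand K2 as [Hw [Iv [Iw [Nvw Nwv]]]].
  assert (exists p c c', wle p p2 /\ Vmem c kappa /\ Vmem c' kappa /\ node p v c /\ node p w c')
    as (p & c & c' & Lp & Hc & Hc' & Nv & Nw).
  { apply NNPP. intros N.
    (* The lengths of [v] and [w] are decided only densely, and [tree_node] proves forced goals;
       hence the contradiction is sought as a forced falsehood. *)
    assert (F : p2 ||- Lit False); [|exact (proj1 (frc_lit _ _ _ _) F)].
    apply (tree_node _ _ _ _ _ (T_tree p2) Hv). intros q c Lq Hc Fv. down Lq.
    apply (tree_node _ _ _ _ _ (T_tree q) Hw). intros q' c' Lq' Hc' Fw. down Lq'.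
    exfalso. apply N. exists q', c, c'. unfold node. tauto. }
  down Lp. apply init_seg_subset in Iv, Iw.
  assert (Ntp : node p t a) by (apply (node_mono top); [apply (le_one P p)|exact Nt]).
  assert (exists m, Vmem m kappa /\ Vsub c m /\ Vsub c' m) as (m & Hm & S1 & S2).
  { destruct (kappa_compare kappa h_kappa c c' Hc Hc') as [H|H].
    - exists c'. repeat split; auto. intros z; auto.
    - exists c. repeat split; auto; [intros z; auto|]. apply (mem_Vsub kappa); assumption. }
  assert (Sam : Vsub a m).
  { pose proof (node_subset_len _ _ _ _ _ Ntp Nv Iv). intros z Hz. auto. }
  (* Only below [p] are [v] and [w] known to be nodes. They are replaced by nodes [y] and [z] named
     by [one] that extend them below [p], on a common level [m], where two different nodes are
     incomparable. *)
  destruct (uniform_extend t a m v Nt Ha Hm Sam c S1) as (y & Ny & Sy & Ey).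
  destruct (uniform_extend t a m w Nt Ha Hm Sam c' S2) as (z & Nz & Sz & Ez).
  specialize (Ey p Nv Iv). specialize (Ez p Nw Iw).
  (* If [y] and [z] were equal, then below [p] both [v] and [w] would be restrictions of one node,
     hence comparable by length. *)
  assert (Neq : ~ top ||- y == z).
  { intros Q. apply (frc_top p) in Q. apply frc_eq_sym in Q. frwin Q Ez.
    assert (Nyp : node p y m) by (apply (node_mono top); [apply (le_one P p)|exact Ny]).
    rewrite frc_not in Nvw, Nwv.
    destruct (kappa_compare kappa h_kappa c c' Hc Hc') as [H|H].
    - apply (Nvw p (wle_refl _ _ _)). apply (node_init_seg _ _ _ _ _ Hc Nv Nw).
      exact (node_subset_of_len _ _ _ _ _ _ _ Nv Nw Nyp Ey Ez H).
    - apply (Nwv p (wle_refl _ _ _)). apply (node_init_seg _ _ _ _ _ Hc' Nw Nv).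
      apply (node_subset_of_len _ _ _ _ _ _ _ Nw Nv Nyp Ez Ey).
      apply (mem_Vsub kappa); assumption. }
  assert (Ext : forall x, node top x m -> top ||- subset t x -> sat (init_seg s (seq x m))).
  { intros x Nx Sx.
    apply (sat_congr (fun s => init_seg s (seq x m)) (seq t a)); [congr_tac|symmetry; exact E|].
    apply seq_init_seg; try assumption. apply seq_sub; assumption. }
  assert (Inc : forall x x', node top x m -> node top x' m -> ~ top ||- x == x' ->
    ~ sat (init_seg (seq x m) (seq x' m))).
  { intros x x' Nx Nx' Q I. apply Q. apply seq_init_seg in I; [|assumption..].
    apply seq_sub in I; [|assumption..].
    apply (node_subset_eq _ _ _ _ _ Nx Nx'); [intros u; auto|exact I]. }
  apply sat_ex. exists (seq y m). split; [apply seq_mem; assumption|].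
  apply sat_ex. exists (seq z m). split; [apply seq_mem; assumption|].
  split; [apply Ext; assumption|]. split; [apply Ext; assumption|]. split.
  - apply Inc; assumption.
  - apply Inc; try assumption. intros Q. apply Neq, frc_eq_sym, Q.
Qed.

Lemma derived_regular : sat (regular_tree derived kappa).
Proof.
  unfold regular_tree. split; [exact derived_tree|]. split; [exact derived_height|].
  split; [|split; [|exact derived_perfect]].
  - intros a. rewrite sat_imp. intros Ha L. rewrite sat_imp. apply derived_levels, Ha.
  - intros b. rewrite sat_imp. apply derived_branch.
Qed.

(** * The classes of [Der] and their order *)

Lemma der_node (x : der_pair kappa T) : node top (dname x) (dlen x).
Proof. destruct (dname_in _ _ x). split; assumption. Qed.

Lemma der_class_eq (x y : der_pair kappa T) :
  der_class x = der_class y <-> top ||- dname x == dname y.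
Proof.
  split.
  - intros H. assert (K : der_equiv x = der_equiv y) by exact (f_equal (@proj1_sig _ _) H).
    change (der_equiv x y). rewrite K. apply forces_eq_refl.
  - intros H. assert (K : der_equiv x = der_equiv y).
    { extensionality z. apply propositional_extensionality. unfold der_equiv.
      split; intros K; [apply (frc_eq_trans _ NM top _ (dname x)); [apply frc_eq_sym|]|
        apply (frc_eq_trans _ NM top _ (dname y))]; assumption. }
    unfold der_class. apply subset_eq_compat. exact K.
Qed.

Lemma der_len_eq (x y : der_pair kappa T) : der_class x = der_class y -> Veq (dlen x) (dlen y).
Proof.
  intros H. apply der_class_eq in H. apply (node_len top (dname y)); [|apply der_node].
  apply (node_eq _ _ _ _ (der_node x) H).
Qed.

Lemma der_class_surj (c : Der kappa T) : exists x, c = der_class x.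
Proof.
  destruct c as [c [x Hx]]. exists x. apply subset_eq_compat. exact Hx.
Qed.

(** [der_lt] speaks of some representatives; inclusion of nodes and comparison of lengths are
    invariant under [der_equiv], so all representatives give the same answer. *)
Lemma der_lt_iff (x y : der_pair kappa T) : der_lt (der_class x) (der_class y) <->
  top ||- subset (dname x) (dname y) /\ Vmem (dlen x) (dlen y).
Proof.
  split.
  - intros (x' & y' & Ex & Ey & H).
    apply (node_proper top _ _ (dlen x') (dlen y')) in H;
      [|apply dlen_lt|apply dlen_lt|apply der_node|apply der_node].
    destruct H as [H1 H2]. split.
    + apply der_class_eq in Ex, Ey. frw Ex. frw Ey. exact H1.
    + rewrite (der_len_eq _ _ Ex), (der_len_eq _ _ Ey). exact H2.
  - intros H. exists x, y. split; [reflexivity|]. split; [reflexivity|].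
    apply (node_proper top _ _ (dlen x) (dlen y));
      [apply dlen_lt|apply dlen_lt|apply der_node|apply der_node|exact H].
Qed.

Lemma seq_proper t u a a' : Vmem a kappa -> Vmem a' kappa -> node top t a -> node top u a' ->
  (sat (proper_init_seg (seq t a) (seq u a')) <-> top ||- subset t u /\ Vmem a a').
Proof.
  intros Ha Ha' Nt Nu. unfold proper_init_seg. cbn [sat].
  rewrite seq_init_seg, seq_sub, seq_eq by assumption. split; intros [S K]; (split; [exact S|]).
  - destruct (kappa_compare kappa h_kappa a' a Ha' Ha) as [H|H]; [|exact H].
    exfalso. apply K. eapply node_subset_eq; eassumption.
  - intros E. apply (Vmem_irrefl a). rewrite (node_len top u a a') at 2; [exact K| |exact Nu].
    eapply node_eq; eassumption.
Qed.

Lemma derived_isomorphic : der_isomorphic kappa T derived.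
Proof.
  assert (exists rep : Der kappa T -> der_pair kappa T, forall c, c = der_class (rep c))
    as [rep Hrep].
  { exists (fun c => proj1_sig (constructive_indefinite_description _ (der_class_surj c))).
    intros c. exact (proj2_sig (constructive_indefinite_description _ (der_class_surj c))). }
  exists (fun c => seq (dname (rep c)) (dlen (rep c))). split; [|split; [|split]].
  - intros c. apply seq_mem; [apply dlen_lt|apply der_node].
  - intros s Hs. apply derived_mem in Hs as (t & a & Ha & Nt & E).
    set (x := DerPair P kappa T t a Ha Nt). exists (der_class x). rewrite E.
    apply seq_eq; [apply dlen_lt|exact Ha|apply der_node|exact Nt|].
    apply (proj1 (der_class_eq (rep (der_class x)) x)). symmetry. apply Hrep.
  - intros c d H. apply seq_eq in H; [|apply dlen_lt|apply dlen_lt|apply der_node|apply der_node].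
    rewrite (Hrep c), (Hrep d). apply der_class_eq, H.
  - intros c d. rewrite seq_proper by (apply dlen_lt || apply der_node).
    rewrite (Hrep c) at 1. rewrite (Hrep d) at 1. apply der_lt_iff.
Qed.

(** A node of length [a + 1] above [x] is always a successor in [Der], as no length lies in between.
    It therefore suffices that, below a condition where [s] is known to be a successor, [s]
    coincides with a node named by [one]; [uniform_extend] supplies it. *)
Lemma successors_named (x : der_pair kappa T) :
  top ||- \all s, (succ_in T (dname x) s \imp
    \ex rho, (Lit (der_succ_name x rho) /\ s == rho)).
Proof.
  pose proof (dlen_lt _ _ x) as Ha. pose proof (der_node x) as Nx.
  set (t := dname x) in *. set (a := dlen x) in *.
  assert (Hsa : Vmem (Vsucc a) kappa) by (apply kappa_succ; assumption).
  assert (Saa : Vsub a (Vsucc a)) by (intros z Hz; apply Vmem_succ; auto).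
  fall s. apply frc_imp. intros q _ H. unfold succ_in in H. fand H as [Hs [Hp Hn]].
  apply (tree_node _ _ _ _ _ (T_tree q) Hs). intros p b Lp Hb Fs. down Lp.
  assert (Ns : node p s b) by (split; assumption).
  assert (Nt : node p t a) by (apply (node_mono top); [apply (le_one P p)|exact Nx]).
  apply (node_proper p t s a b) in Hp; [|assumption..]. destruct Hp as [St Hab].
  assert (Sb : Vsub (Vsucc a) b) by (apply (succ_Vsub kappa); assumption).
  destruct (res_spec p s b (Vsucc a) Hb Hsa Sb Ns) as [Nr Sr].
  assert (Htr : p ||- proper_init_seg t (res s (Vsucc a))).
  { apply (node_proper p _ _ a (Vsucc a)); try assumption. split.
    - exact (node_subset_of_len _ _ _ _ _ _ _ Nt Nr Ns St Sr Saa).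
    - apply Vmem_succ. right. reflexivity. }
  (* An immediate successor has length [a + 1]: otherwise its restriction to [Vsucc a] would lie
     strictly between [t] and [s]. *)
  assert (Er : p ||- res s (Vsucc a) == s).
  { apply frc_by_contra. intros r Lr N. down Lr. rewrite frc_not in Hn.
    apply (Hn r (wle_refl _ _ _)). fwit (res s (Vsucc a)).
    fsplit; [apply (node_mono _ _ _ _ Lr) in Nr; apply Nr|].
    fsplit; [exact Htr|]. unfold proper_init_seg. fsplit; [|exact N].
    apply (node_init_seg _ _ _ (Vsucc a) b); [exact Hsa|eapply node_mono; eassumption|
      eapply node_mono; eassumption|exact Sr]. }
  assert (Ns' : node p s (Vsucc a)) by exact (node_eq _ _ _ _ Nr Er).
  destruct (uniform_extend t a (Vsucc a) s Nx Ha Hsa Saa (Vsucc a)) as (y & Ny & Sy & Ey);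
    [intros z; auto|].
  specialize (Ey p Ns' St). fwit y. fsplit.
  - apply frc_lit. set (yp := DerPair P kappa T y (Vsucc a) Hsa Ny). exists yp.
    split; [reflexivity|]. split.
    + intros w. rewrite sat_iff, sat_or. apply Vmem_succ.
    + split.
      * apply der_lt_iff. split; [exact Sy|]. apply Vmem_succ. right. reflexivity.
      * intros (c & H1 & H2). destruct (der_class_surj c) as [z ->].
        apply der_lt_iff in H1 as [_ H1]. apply der_lt_iff in H2 as [_ H2].
        apply Vmem_succ in H2 as [H2|H2].
        -- exact (Vmem_asym _ _ H1 H2).
        -- rewrite H2 in H1. exact (Vmem_irrefl _ H1).
  - assert (Nyp : node p y (Vsucc a)) by (apply (node_mono top); [apply (le_one P p)|exact Ny]).
    apply (node_subset_eq _ _ _ _ _ Ns' Nyp); [intros z; auto|exact Ey].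
Qed.

End Coding.

End Derived.

Theorem theorem3p2 (kappa : V) (P : forcing) (T : name P)
    (h_kappa : sat (inaccessible kappa))
    (h_P : size_lt P kappa)
    (h_T : forces one (regular_tree T (check kappa))) :
  (exists S : V, sat (regular_tree S kappa) /\ der_isomorphic kappa T S)
  /\
  (forall x : der_pair kappa T,
     forces one
       (\all s, (succ_in T (dname x) s \imp
                 \ex rho, (Lit (der_succ_name x rho) /\ s == rho)))%form).
Proof.
  destruct (size_lt_rank P kappa h_P)
    as (xP & e & SP & o & e_mem & e_surj & e_inj & xP_small & o_mem & o_inj).
  destruct (code_exists kappa P T h_kappa SP xP e o e_mem e_surj e_inj xP_small o_mem o_inj h_T)
    as [code Hcode].
  destruct (restrict_exists kappa P T h_kappa SP h_T) as [res Hres].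
  split.
  - exists (derived kappa P T SP code res). split.
    + eapply derived_regular; eassumption.
    + eapply derived_isomorphic; eassumption.
  - intros x. eapply (successors_named kappa P T h_kappa SP o o_mem o_inj h_T); eassumption.
Qed.
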